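(* Let $m\ge1$ be an integer and $p\in\mathbb Z$. The linear map $V_{(m),p}\to A_{(m)}$, $$a_{j_1}\cdots a_{j_s}v_p\ \mapsto\ \xi_{-j_1+p-1}\cdots\xi_{-j_s+p-1}\qquad (s\ge 0,\ j_1,\ldots,j_s\le p-1),$$ is a well-defined isomorphism.
   Context: Fix an integer $m\ge 1$. Let $H$ be the Heisenberg Lie algebra with basis $h_i$, $i\in\mathbb Z$, $[h_i,h_j]=i\,\delta_{i+j,0}$ (the central element acts as $1$). For a scalar $\lambda$ let $H_\lambda$ be the highest weight (Fock) representation with highest weight vector $|\lambda\rangle$: $h_i|\lambda\rangle=0$ for $i>0$, $h_0|\lambda\rangle=\lambda|\lambda\rangle$, and $H_\lambda=\mathbb C[h_{-1},h_{-2},\ldots]|\lambda\rangle$ is free over $\mathbb C[h_{-1},h_{-2},\ldots]$. For $0\le i\le 2m-1$ put $L_{(m),i}=\bigoplus_{n\in\mathbb Z}H_{(2nm+i)/\sqrt{2m}}$. On $\bigoplus_i L_{(m),i}$ the bosonic vertex operator is $$\phi_{\sqrt{2m}}(z)=\exp\Big(\sqrt{2m}\sum_{n>0}\tfrac{h_{-n}}{n}z^n\Big)\exp\Big(-\sqrt{2m}\sum_{n>0}\tfrac{h_{n}}{n}z^{-n}\Big)\,T\,z^{\sqrt{2m}\,h_0}=\sum_{n\in\mathbb Z}a_nz^{-n-1},$$ where $T$ commutes with all $h_i$, $i\ne0$, and $T|\lambda\rangle=|\lambda+\sqrt{2m}\rangle$. The operators $a_n$ pairwise commute. Put $v_p=\left|\frac{-p}{\sqrt{2m}}\right\rangle$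 for $p\in\mathbb Z$; then $a_iv_p=0$ for $i\ge p$. The principal subspace is $V_{(m),p}=\mathbb C[a_{p-1},a_{p-2},\ldots]\cdot v_p$. The algebra $A_{(m)}$ is the quotient of the polynomial algebra $\mathbb C[\xi_0,\xi_1,\ldots]$ by the ideal generated by all coefficients of the power series $(\xi(z)^{(i)})^2$, $i=0,1,\ldots,m-1$, where $\xi(z)=\sum_{j\ge0}\xi_jz^j$ and $\xi(z)^{(i)}$ is its $i$-th derivative in $z$. *)

(* Defs.v *)
From HB Require Import structures.
From mathcomp Require Import all_boot all_order all_algebra.
From mathcomp Require Import finmap.
From mathcomp.multinomials Require Import freeg monalg.
From mathcomp Require Import boolp.

Set Implicit Arguments.
Unset Strict Implicit.
Unset Printing Implicit Defensive.

Import Order.TTheory GRing.Theory Num.Theory.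

Local Open Scope ring_scope.

(* A monomial mu : {cmonom nat} stands for prod_i h_{-(i+1)} ^ (mu i), and the
   basis vector [fvec k mu] for the product of this monomial with the highest
   weight vector |k / sqrt(2m)>.  The fvec k mu with k fixed span
   H_{k / sqrt(2m)}, so Fock is the sum of the H_{k / sqrt(2m)}, k in Z, that
   is, the sum of all L_{(m),i}, 0 <= i < 2m. *)
Notation Fock C := {freeg (int * {cmonom nat})%type / C}.

(* fvec, mulX and divX are locked because conversion is very slow when it
   unfolds the finite maps behind cmonom. *)
HB.lock Definition fvec (C : numClosedFieldType) (k : int)
  (mu : {cmonom nat}) : Fock C := Freeg [:: (1, (k, mu))].

HB.lock Definition mulX (mu : {cmonom nat}) (i : nat) : {cmonom nat} :=
  mulcm mu (ucm i).

HB.lock Definition divX (mu : {cmonom nat}) (i : nat) : {cmonom nat} :=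
  divcm mu (ucm i).

Lemma mulXE mu i j : mulX mu i j = (mu j + (i == j))%N.
Proof. by rewrite mulX.unlock mulcmE ucmE. Qed.

Lemma divXE mu i j : divX mu i j = (mu j - (i == j))%N.
Proof. by rewrite divX.unlock divcmE ucmE. Qed.

Section Bosons.

Variable C : numClosedFieldType.
Local Notation fvec := (fvec C).
Implicit Types (u v : Fock C) (mu nu : {cmonom nat}) (k : int).

Definition lin_ext (f : int -> {cmonom nat} -> Fock C) : Fock C -> Fock C :=
  fglift (fun b => f b.1 b.2).

Lemma lin_extE f k mu : lin_ext f (fvec k mu) = f k mu.
Proof. by rewrite fvec.unlock /lin_ext liftU scale1r. Qed.

Lemma fvec_sum v : v = \sum_(b <- dom v) coeff b v *: fvec b.1 b.2.
Proof.
rewrite -[LHS]freeg_sumE; apply: eq_bigr => -[k mu] _.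
apply/eqP/freeg_eqP => c; rewrite fvec.unlock coeffZ !coeffU.
by rewrite mul1r.
Qed.

Lemma lin_ext_is_additive f : zmod_morphism (lin_ext f).
Proof. exact: lift_is_additive. Qed.

HB.instance Definition _ f :=
  GRing.isZmodMorphism.Build (Fock C) (Fock C) (lin_ext f)
    (lin_ext_is_additive f).

Lemma lin_ext_is_scalable f : scalable (lin_ext f).
Proof.
have liftZU a b : lin_ext f (Freeg [:: (a, b)]) = a *: f b.1 b.2.
  exact: liftU.
move=> a v.
have -> : lin_ext f v = \sum_(b <- dom v) coeff b v *: f b.1 b.2.
  rewrite -[v in LHS]freeg_sumE (raddf_sum (lin_ext f)).
  by apply: eq_bigr => b _; exact: liftZU.
rewrite scaler_sumr.
have -> : a *: v = \sum_(b <- dom v) Freeg [:: (a * coeff b v, b)] by [].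
rewrite (raddf_sum (lin_ext f)); apply: eq_bigr => b _.
by rewrite /= liftZU scalerA.
Qed.

HB.instance Definition _ f :=
  GRing.isScalable.Build C (Fock C) (Fock C) *:%R (lin_ext f)
    (lin_ext_is_scalable f).

Variable m : nat.

Definition sqrt2m : C := sqrtC (2 * m)%:R.

(* Heisenberg generators: h_{-n} multiplies by h_{-n} and h_n is n d/dh_{-n},
   for n > 0.  Recall that [Negz n] is -(n+1). *)
Definition heis (i : int) : Fock C -> Fock C :=
  lin_ext (fun k mu =>
    match i with
    | Posz 0 => (k%:~R / sqrt2m) *: fvec k mu
    | Posz n.+1 => (n.+1 * mu n)%N%:R *: fvec k (divX mu n)
    | Negz n => fvec k (mulX mu n)
    end).

(* |k / sqrt(2m)> *)
Definition hwv k : Fock C := fvec k (onecm nat).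

(* |lambda> |-> |lambda + sqrt(2m)>, since sqrt(2m) = 2m / sqrt(2m). *)
Definition shiftT : Fock C -> Fock C :=
  lin_ext (fun k mu => fvec (k + (2 * m)%:Z) mu).

(* Formal power series with operator coefficients, in a variable w. *)
Definition op_series := nat -> Fock C -> Fock C.

Definition os_one : op_series := fun n v => if n == 0%N then v else 0.

Definition os_mul (f g : op_series) : op_series :=
  fun n v => \sum_(i < n.+1) f i (g (n - i)%N v).

(* Exponential of a series f with f_0 = 0: the powers f^s with s > n do not
   contribute to the coefficient of w^n. *)
Definition os_exp (f : op_series) : op_series :=
  fun n v => \sum_(s < n.+1) (s`!%:R)^-1 *: iter s (os_mul f) os_one n v.

(* The two exponential factors of the vertex operator, with w = z for the
   first one and w = z^{-1} for the second one. *)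
Definition exp_minus : op_series := os_exp (fun n v =>
  if n == 0%N then 0 else (sqrt2m / n%:R) *: heis (- n%:Z) v).

Definition exp_plus : op_series := os_exp (fun n v =>
  if n == 0%N then 0 else - (sqrt2m / n%:R) *: heis n%:Z v).

Definition coefz (f : op_series) (e : int) v : Fock C :=
  if e is Posz i then f i v else 0.

(* Degree of a monomial, with deg h_{-n} = n. *)
Definition wdeg mu : nat := (\sum_(i <- finsupp mu) i.+1 * mu i)%N.

(* a_n is the coefficient of z^{-n-1} in exp_minus(z) exp_plus(z^{-1}) T
   z^{sqrt(2m) h_0}.  On H_{k / sqrt(2m)} the last factor is z^k; if exp_plus
   contributes z^{-j}, then exp_minus contributes z^e with e - j + k = -n-1.
   The sum over j >= 0 stops at the degree of mu since the later terms vanish,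
   see [exp_plus_vanish] and [vopE]. *)
Definition vop_term (n : int) k mu (j : nat) : Fock C :=
  coefz exp_minus (j%:Z - k - n - 1) (exp_plus j (shiftT (fvec k mu))).

Definition vop (n : int) : Fock C -> Fock C :=
  lin_ext (fun k mu => \sum_(j < (wdeg mu).+1) vop_term n k mu j).

(* Validation of the model: Heisenberg relations, highest weight conditions,
   properties of T and independence of vop from the bound on j. *)
HB.instance Definition _ i := GRing.Linear.on (heis i).
HB.instance Definition _ := GRing.Linear.on shiftT.
HB.instance Definition _ n := GRing.Linear.on (vop n).

Lemma sqrt2m_neq0 : (0 < m)%N -> sqrt2m != 0.
Proof. by rewrite sqrtC_eq0 pnatr_eq0 -lt0n muln_gt0. Qed.

Lemma linear_eq (f g : {linear Fock C -> Fock C}) :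
  (forall k mu, f (fvec k mu) = g (fvec k mu)) -> f =1 g.
Proof.
move=> fg v; rewrite [v]fvec_sum !linear_sum.
by apply: eq_bigr => b _; rewrite !linearZ /= fg.
Qed.

Lemma heisZ i a v : heis i (a *: v) = a *: heis i v.
Proof. exact: linearZ. Qed.

Lemma heis0E k mu : heis 0 (fvec k mu) = (k%:~R / sqrt2m) *: fvec k mu.
Proof. exact: lin_extE. Qed.

Lemma heis_posE (n : nat) k mu : heis n.+1 (fvec k mu) =
  (n.+1 * mu n)%N%:R *: fvec k (divX mu n).
Proof. exact: lin_extE. Qed.

Lemma heis_negE (n : nat) k mu :
  heis (Negz n) (fvec k mu) = fvec k (mulX mu n).
Proof. exact: lin_extE. Qed.

Lemma divXK mu i : mu i != 0%N -> mulX (divX mu i) i = mu.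
Proof.
move=> mui; apply/eqP/cmP => j; rewrite mulXE divXE.
by case: eqP => [<-|_]; rewrite ?subn0 ?addn0 // subnK // lt0n.
Qed.

Lemma mulXK mu i : divX (mulX mu i) i = mu.
Proof. by apply/eqP/cmP => j; rewrite divXE mulXE addnK. Qed.

Lemma heis_pnC (n l : nat) k mu :
  heis n.+1 (heis (Negz l) (fvec k mu)) - heis (Negz l) (heis n.+1 (fvec k mu))
  = (if n == l then n.+1%:R else 0) *: fvec k mu.
Proof.
rewrite heis_negE !heis_posE heisZ heis_negE mulXE eq_sym.
case: eqP => [->|nl].
  rewrite mulXK; have [->|mul] := eqVneq (mu l) 0%N.
    by rewrite muln0 scale0r subr0 muln1.
  by rewrite divXK // -scalerBl mulnDr muln1 natrD addrAC subrr add0r.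
rewrite addn0 scale0r; have [->|mun] := eqVneq (mu n) 0%N.
  by rewrite muln0 !scale0r subrr.
suff -> : divX (mulX mu l) n = mulX (divX mu n) l.
  by rewrite subrr.
apply/eqP/cmP => j; rewrite divXE !mulXE divXE.
have [<-|_] := eqVneq n j; last by rewrite !subn0.
by case: eqP nl => [->|_ _] //; rewrite !addn0.
Qed.

Lemma heis_comm i j v :
  heis i (heis j v) - heis j (heis i v) =
  (if i + j == 0 then i%:~R else 0) *: v.
Proof.
set c := (if _ then _ else _).
pose f : {linear Fock C -> Fock C} := (heis i \o heis j) \- (heis j \o heis i).
pose g : {linear Fock C -> Fock C} := c \*: idfun.
suff : f =1 g by apply.
apply: linear_eq => k mu; rewrite /f /g /= {f g}/c.
case: i j => [[|n]|n] [[|l]|l].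
- by rewrite subrr scale0r.
- rewrite heis_posE !heis0E !heisZ heis0E heis_posE !scalerA.
  by rewrite [X in X *: _ - _]mulrC subrr scale0r.
- by rewrite heis_negE !heis0E !heisZ heis_negE subrr scale0r.
- rewrite heis_posE !heis0E !heisZ heis0E heis_posE !scalerA.
  by rewrite [X in X *: _ - _]mulrC subrr scale0r.
- rewrite !heis_posE !heisZ !heis_posE !scalerA -!natrM /= scale0r.
  have -> : divX (divX mu l) n =
            divX (divX mu n) l.
    by apply/eqP/cmP => j; rewrite !divXE subnAC.
  rewrite !divXE (eq_sym l); have [->|_] := eqVneq n l.
    by rewrite subrr.
  by rewrite !subn0 [X in X%:R *: _ - _]mulnC subrr.
- by rewrite heis_pnC NegzE subr_eq0 eqz_nat eqSS.
- by rewrite heis_negE !heis0E !heisZ heis_negE subrr scale0r.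
- rewrite -opprB heis_pnC -scaleNr !NegzE addrC subr_eq0 eqz_nat eqSS.
  by case: eqP => [->|]; rewrite ?oppr0 // mulrNz.
- rewrite !heis_negE /= scale0r.
  suff -> : mulX (mulX mu l) n = mulX (mulX mu n) l by rewrite subrr.
  by apply/eqP/cmP => j; rewrite !mulXE addnAC.
Qed.

Lemma heis_hwv (n : nat) k : heis n.+1 (hwv k) = 0.
Proof. by rewrite heis_posE onecmE muln0 scale0r. Qed.

Lemma heis0_hwv k : heis 0 (hwv k) = (k%:~R / sqrt2m) *: hwv k.
Proof. exact: heis0E. Qed.

Lemma shiftTZ a v : shiftT (a *: v) = a *: shiftT v.
Proof. exact: linearZ. Qed.

Lemma shiftTE k mu : shiftT (fvec k mu) = fvec (k + (2 * m)%:Z) mu.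
Proof. exact: lin_extE. Qed.

Lemma shiftT_heis i v : i != 0 -> shiftT (heis i v) = heis i (shiftT v).
Proof.
move=> i0; pose f : {linear Fock C -> Fock C} := shiftT \o heis i.
pose g : {linear Fock C -> Fock C} := heis i \o shiftT.
suff : f =1 g by apply.
apply: linear_eq => k mu; rewrite /f /g /= shiftTE.
by case: i i0 {f g} => [[|n]|n] // _;
  rewrite ?heis_posE ?heis_negE ?shiftTZ shiftTE.
Qed.

Lemma heis0_shiftT v :
  (0 < m)%N -> heis 0 (shiftT v) = shiftT (heis 0 v + sqrt2m *: v).
Proof.
move=> m0; pose f : {linear Fock C -> Fock C} := heis 0 \o shiftT.
pose g : {linear Fock C -> Fock C} :=
  shiftT \o (heis 0 \+ (sqrt2m \*: idfun)).
suff : f =1 g by apply.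
apply: linear_eq => k mu; rewrite /f /g /= shiftTE !heis0E -scalerDl.
rewrite shiftTZ shiftTE; congr (_ *: _).
by rewrite intrD mulrDl -[(2 * m)%:~R]sqrtCK expr2 mulfK ?sqrt2m_neq0.
Qed.

(* Hence z^{sqrt(2m) h_0} acts on fvec k mu as z^k. *)
Lemma sqrt2m_heis0 k mu : (0 < m)%N ->
  sqrt2m *: heis 0 (fvec k mu) = k%:~R *: fvec k mu.
Proof.
by move=> m0; rewrite heis0E scalerA mulrC mulfVK ?sqrt2m_neq0.
Qed.

Lemma wdegEw (d : {fset nat}) mu : (finsupp mu `<=` d)%fset ->
  wdeg mu = (\sum_(i <- d) i.+1 * mu i)%N.
Proof.
move=> le; rewrite /wdeg (big_fset_incl _ le) // => i _.
by rewrite -cmE_eq0 => /eqP->; rewrite muln0.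
Qed.

Lemma wdegM mu nu : wdeg (mulcm mu nu) = (wdeg mu + wdeg nu)%N.
Proof.
pose d := (finsupp mu `|` finsupp nu)%fset.
rewrite (@wdegEw d) ?mdomD // (@wdegEw d mu) ?fsubsetUl //.
rewrite (@wdegEw d nu) ?fsubsetUr // -big_split /=.
by apply: eq_bigr => i _; rewrite mulcmE mulnDr.
Qed.

Lemma wdegU i : wdeg (ucm i) = i.+1.
Proof. by rewrite /wdeg mdomU big_seq_fset1 ucmE eqxx muln1. Qed.

Lemma wdegX mu i : wdeg (mulX mu i) = (wdeg mu + i.+1)%N.
Proof. by rewrite mulX.unlock wdegM wdegU. Qed.

Definition homog (w : int) v :=
  forall b, (wdeg b.2)%:Z != w -> coeff b v = 0.

Lemma homog0 w : homog w 0.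
Proof. by move=> b _; rewrite coeff0. Qed.

Lemma homogD w u v : homog w u -> homog w v -> homog w (u + v).
Proof. by move=> hu hv b bw; rewrite coeffD hu // hv // addr0. Qed.

Lemma homogZ w a v : homog w v -> homog w (a *: v).
Proof. by move=> hv b bw; rewrite coeffZ hv // mulr0. Qed.

Lemma homogU w k mu : (wdeg mu)%:Z = w -> homog w (fvec k mu).
Proof.
move=> muw b bw; rewrite fvec.unlock coeffU.
have [eb|_] := eqVneq; last by rewrite mulr0.
by move: bw; rewrite -eb /= muw eqxx.
Qed.

Lemma homog_sum w (I : Type) (r : seq I) (P : pred I) (F : I -> Fock C) :
  (forall i, P i -> homog w (F i)) -> homog w (\sum_(i <- r | P i) F i).
Proof. by move=> FP; elim/big_ind: _ => //; [exact: homog0|exact: homogD]. Qed.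

Lemma homog_heis w (n : nat) v :
  homog w v -> homog (w - n%:Z) (heis n%:Z v).
Proof.
move=> hv; rewrite [v]fvec_sum linear_sum.
apply: homog_sum => -[k mu] _; rewrite /= heisZ.
have [muw|/(hv (k, mu))->] := eqVneq (wdeg mu)%:Z w; last first.
  by rewrite scale0r; exact: homog0.
apply: homogZ; case: n => [|n].
  by rewrite subr0 heis0E; apply/homogZ/homogU.
rewrite heis_posE; have [->|mun] := eqVneq (mu n) 0%N.
  by rewrite muln0 scale0r; exact: homog0.
apply/homogZ/homogU.
by rewrite -muw -[in RHS](divXK mun) wdegX PoszD addrK.
Qed.

Lemma homog_exp_plus w j v : homog w v -> homog (w - j%:Z) (exp_plus j v).
Proof.
move=> hv; apply: homog_sum => -[s /= _] _; apply: homogZ.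
elim: s j => [|s IHs] j /=.
  by rewrite /os_one; case: eqP => [->|_]; rewrite ?subr0 //; exact: homog0.
apply: homog_sum => i _; case: eqP => _; first exact: homog0.
have -> : w - j%:Z = w - (j - i)%N%:Z - i%:Z.
  by rewrite -addrA -opprD -PoszD subnK // -ltnS.
by apply/homogZ/homog_heis/IHs.
Qed.

Lemma exp_plus_vanish k mu j :
  (wdeg mu < j)%N -> exp_plus j (fvec k mu) = 0.
Proof.
move=> muj; have := @homog_exp_plus (wdeg mu)%:Z j _ (@homogU _ k _ erefl).
move: (exp_plus _ _) => v hv; apply/eqP/freeg_eqP => b; rewrite coeff0 hv //.
apply: contraTneq muj => bw; rewrite -leqNgt -lez_nat -subr_ge0.
by move: bw => <-.
Qed.

Lemma exp_minus0 n : exp_minus n 0 = 0.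
Proof.
rewrite /exp_minus; set f := (X in os_exp X).
rewrite /os_exp big1 // => -[s /= _] _.
suff -> : iter s (os_mul f) os_one n 0 = 0 by rewrite scaler0.
elim: s n => [|s IHs] n /=; first by rewrite /os_one if_same.
rewrite /os_mul big1 // => l _; rewrite IHs /f; case: eqP => // _.
by rewrite linear0 scaler0.
Qed.

Lemma vopE n k mu N : (wdeg mu <= N)%N ->
  vop n (fvec k mu) = \sum_(j < N.+1) vop_term n k mu j.
Proof.
move=> muN; rewrite /vop lin_extE -ltnS in muN *.
rewrite -!(big_mkord predT (vop_term n k mu)) /=.
rewrite [RHS](big_cat_nat (leq0n _) muN) /=.
rewrite [X in _ + X]big_nat_cond [X in _ + X]big1 ?addr0 // => j.
rewrite andbT => /andP[muj _].
rewrite /vop_term shiftTE exp_plus_vanish //.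
by case: (_ - _ - 1) => //= i; exact: exp_minus0.
Qed.

Definition vp (p : int) : Fock C := hwv (- p).

Lemma vop_vp (i p : int) : p <= i -> vop i (vp p) = 0.
Proof.
move=> lepi; rewrite (@vopE _ _ _ 0%N); last first.
  by rewrite /wdeg mdom1 big_seq_fset0.
rewrite big_ord1 /vop_term sub0r opprK.
case E: (p - i - 1) => [e|] //; have : p - i - 1 < 0.
  by rewrite subr_lt0 (le_lt_trans _ ltr01) // subr_le0.
by rewrite E.
Qed.

Definition vop_word (p : int) (js : seq int) : Fock C := foldr vop (vp p) js.

(* C[a_{p-1}, a_{p-2}, ...] v_p, the span of the words applied to v_p. *)
Definition principal (p : int) : {pred Fock C} := fun v =>
  `[< exists s : seq (C * seq int),
        {in s, forall cj, all (fun j => j <= p - 1) cj.2} /\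
        v = \sum_(cj <- s) cj.1 *: vop_word p cj.2 >].

Lemma principal_submod_closed p : submod_closed (principal p).
Proof.
split; first by apply/asboolP; exists [::]; split=> //; rewrite big_nil.
move=> a u v /asboolP[s [sP ->]] /asboolP[t [tP ->]]; apply/asboolP.
exists ([seq (a * cj.1, cj.2) | cj <- s] ++ t); split.
  by move=> cj; rewrite mem_cat => /orP[/mapP[x xs ->] /=|/tP//]; exact: sP.
rewrite big_cat big_map /= scaler_sumr; congr (_ + _).
by apply: eq_bigr => cj _; rewrite scalerA.
Qed.

HB.instance Definition _ p :=
  GRing.isSubmodClosed.Build C (Fock C) (principal p)
    (principal_submod_closed p).

Record principal_space (p : int) := PrincipalSpace {
  pval : Fock C;
  pvalP : pval \in principal p
}.

HB.instance Definition _ p := [isSub for @pval p].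
HB.instance Definition _ p := [Choice of principal_space p by <:].
HB.instance Definition _ p :=
  [SubChoice_isSubLmodule of principal_space p by <:].

Lemma vop_word_principal p js :
  all (fun j => j <= p - 1) js -> vop_word p js \in principal p.
Proof.
move=> jsP; apply/asboolP; exists [:: (1, js)]; split.
  by move=> cj; rewrite inE => /eqP->.
by rewrite big_seq1 scale1r.
Qed.

Definition principal_word p js (jsP : all (fun j => j <= p - 1) js) :
  principal_space p := PrincipalSpace (vop_word_principal jsP).

End Bosons.

Section GeneratedIdeal.

Variables (R : comNzRingType) (G : R -> Prop).

Definition gen_ideal : {pred R} := fun q =>
  `[< exists s : seq (R * R),
        {in s, forall c, G c.2} /\ q = \sum_(c <- s) c.1 * c.2 >].

Lemma gen_ideal_closed (S : nzRingType) (e : {rmorphism R -> S}) :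
  (forall g, G g -> e g = 0) -> idealr_closed gen_ideal.
Proof.
move=> eG; split.
- by apply/asboolP; exists [::]; split=> //; rewrite big_nil.
- apply/asboolP => -[s [sG /(congr1 e)/eqP]]; apply/negP.
  rewrite rmorph1 rmorph_sum big_seq big1 ?oner_eq0 // => c cs.
  by rewrite rmorphM (eG _ (sG c cs)) mulr0.
move=> a u v /asboolP[s [sG ->]] /asboolP[t [tG ->]]; apply/asboolP.
exists ([seq (a * c.1, c.2) | c <- s] ++ t); split.
  by move=> c; rewrite mem_cat => /orP[/mapP[x xs ->] /=|/tG//]; exact: sG.
rewrite big_cat big_map /= mulr_sumr; congr (_ + _).
by apply: eq_bigr => c _; rewrite mulrA.
Qed.

End GeneratedIdeal.

Section ScalarPullback.

Variables (K A : nzRingType) (e : {rmorphism K -> A}).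

Definition pull_scale (c : K) (x : A) : A := e c * x.

Lemma pull_scaleA a b x :
  pull_scale a (pull_scale b x) = pull_scale (a * b) x.
Proof. by rewrite /pull_scale mulrA rmorphM. Qed.

Lemma pull_scale1 : left_id 1 pull_scale.
Proof. by move=> x; rewrite /pull_scale rmorph1 mul1r. Qed.

Lemma pull_scaleDr : right_distributive pull_scale +%R.
Proof. by move=> a x y; exact: mulrDr. Qed.

Lemma pull_scaleDl x : {morph pull_scale^~ x : a b / a + b}.
Proof. by move=> a b; rewrite /pull_scale rmorphD mulrDl. Qed.

End ScalarPullback.

Section Algebra.

Variables (C : numClosedFieldType) (m : nat).

(* C[xi_0, xi_1, ...] *)
Local Notation polyxi := {malg C[{cmonom nat}]}.

Definition xi (j : nat) : polyxi := << ucm j >>.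

(* Sequences of coefficients of formal power series in z *)
Definition fps := nat -> polyxi.

Definition fps_deriv (f : fps) : fps := fun k => f k.+1 *+ k.+1.

Definition fps_mul (f g : fps) : fps :=
  fun k => \sum_(i < k.+1) f i * g (k - i)%N.

Definition xi_deriv (i : nat) : fps := iter i fps_deriv xi.

Definition A_relation (q : polyxi) : Prop :=
  exists2 i, (i < m)%N & exists k, q = fps_mul (xi_deriv i) (xi_deriv i) k.

Definition A_ideal : {pred polyxi} := gen_ideal A_relation.

Lemma A_ideal_closed : idealr_closed A_ideal.
Proof.
apply: (gen_ideal_closed (e := mcoeff mone)) => _ [i _ [k ->]].
have xi0 j l : (xi_deriv j l)@_mone = 0.
  elim: j l => [|j IHj] l; rewrite /xi_deriv /=.
    rewrite mcoeffU1; case: eqP => // /eqP/cmP/(_ l).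
    by rewrite cmUU cm1.
  by rewrite /fps_deriv mcoeffMn IHj mul0rn.
rewrite rmorph_sum big1 //= => j _.
by rewrite (rmorphM (mcoeff mone)) /= xi0 mul0r.
Qed.

HB.instance Definition _ := isIdealr.Build polyxi A_ideal A_ideal_closed.

Definition A_alg := {ideal_quot A_ideal}.

HB.instance Definition _ := GRing.ComNzRing.on A_alg.

Definition A_pi : {rmorphism polyxi -> A_alg} := \pi_({ideal_quot A_ideal})%qT.

(* The quotient is a C-algebra through the constant polynomials. *)
Definition A_const : {rmorphism C -> A_alg} := A_pi \o @malgC {cmonom nat} C.

HB.instance Definition _ := GRing.Zmodule_isLmodule.Build C A_alg
  (pull_scaleA A_const) (pull_scale1 A_const)
  (pull_scaleDr A_const) (pull_scaleDl A_const).

Lemma A_scaleAl a (x y : A_alg) : a *: (x * y) = a *: x * y.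
Proof. exact: mulrA. Qed.

HB.instance Definition _ := GRing.Lmodule_isLalgebra.Build C A_alg A_scaleAl.

Lemma A_piZ a q : A_pi (a *: q) = a *: A_pi q.
Proof. by rewrite -mul_malgC (rmorphM A_pi). Qed.

Definition xiA (j : nat) : A_alg := A_pi (xi j).

End Algebra.

(* Main.v *)
Require Import Defs.
From HB Require Import structures.
From mathcomp Require Import all_boot all_order all_algebra.
From mathcomp Require Import finmap.
From mathcomp.multinomials Require Import freeg monalg.
From mathcomp Require Import boolp reals zify ring.
From mathcomp.real_closed Require Import complex.

(** Put b_i = a_(p-1-i), so that the map in question should send b_i to xi_i.
    The proof goes in the opposite direction: evaluating polynomials in the
    xi_i at the operators b_i and applying the result to v_p gives a linear
    map [word_map] from C[xi_0, xi_1, ...] onto the principal subspace, and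
    the point is that its kernel is exactly the ideal of relations
    ([word_map_eq0]).

    The evaluation makes sense because the operators commute, and it kills the
    ideal because of the factor (z - w)^(2m) in phi(z) phi(w). Indeed phi(z)
    phi(w) v_p is, up to a power of z w, this factor times a symmetric series
    ([vop_vop_vp]), so that sum_x q(x) b_x b_(n-x) v_p is a combination of
    differences of order 2m of the polynomial q, and vanishes if q has degree
    less than 2m ([vop_quad]). The relation attached to the i-th derivative of
    xi(z) is of this form, with q of degree 2i.

    For the converse, consider the monomials in which any two indices differ
    by at least 2m. They span the algebra ([spanned_prod]): for a fixed sum n
    of two indices x and n - x, the m quadratic relations yield all those
    whose coefficients are a polynomial of degree less than m in x (n - x),
    and by interpolation these express each product of two close variables
    through products of distant ones ([near_in_span_far]); repeating this
    increases the sum of the squares of the indices and therefore stops.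

    Their images in the Fock space are linearly independent ([bword_free]).
    The eigenvalues of h_0 separate the lengths. The half vertex operator G(z)
    = exp (- (2m)^(-1/2) sum_(n > 0) (h_n / n) z^-n) satisfies G(z) phi(w) =
    (1 - w/z) phi(w) G(z), so its coefficient of z^-L lowers by one all the
    indices of a product of L operators b_i, up to sign ([lowering_word]).
    Since b_(-1) v_p = 0, this kills the products that contain b_0. Those that
    do contain it have one factor less when written with v_(p-2m) = b_0 v_p,
    and an induction concludes. *)

Set Implicit Arguments.
Unset Strict Implicit.
Unset Printing Implicit Defensive.

Import Order.TTheory GRing.Theory Num.Theory.

Local Open Scope ring_scope.

(** * Finite differences *)

Lemma sum_shift (V : nmodType) (F : nat -> V) (N j : nat) :
  (forall t, (N <= t)%N -> F t = 0) ->
  \sum_(x < N) F (x + j)%N = \sum_(y < N | (j <= y)%N) F y.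
Proof.
move=> F0; rewrite -(big_mkord xpredT (fun x => F (x + j)%N)).
rewrite -(big_mkord (fun y => (j <= y)%N) F).
have -> : \sum_(0 <= x < N) F (x + j)%N = \sum_(j <= y < N + j) F y.
  by rewrite -{2}[j]add0n big_addn addnK.
have [jN|Nj] := leqP j N.
  rewrite (@big_cat_nat _ _ _ N) ?leq_addr //=.
  rewrite [X in _ + X]big_nat_cond [X in _ + X]big1 ?addr0; last first.
    by move=> t /andP[/andP[Nt _] _]; exact: F0.
  rewrite (@big_cat_nat _ _ _ j 0 N) //= [X in _ = X + _]big_nat_cond.
  rewrite [X in _ = X + _]big1 ?add0r; last first.
    by move=> t /andP[/andP[_ tj] jt]; rewrite leqNgt tj in jt.
  rewrite big_nat_cond [RHS]big_nat_cond; apply: eq_bigl => t.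
  by case: (j <= t)%N; rewrite ?andbT.
rewrite [LHS]big_nat_cond [LHS]big1; last first.
  by move=> t /andP[/andP[jt _] _]; apply: F0; exact: leq_trans (ltnW Nj) jt.
rewrite [RHS]big_nat_cond [RHS]big1 // => t /andP[/andP[_ tN] jt].
by have := leq_trans (leq_ltn_trans jt tN) (ltnW Nj); rewrite ltnn.
Qed.

Definition sign_bin (R : pzRingType) (M j : nat) : R := (-1) ^+ j * 'C(M, j)%:R.

(** The differential equation of (1 - t)^M, in the form asked for by
    exp_series_family. *)
Lemma sign_bin_rec (R : comNzRingType) (M t : nat) :
  t%:R * sign_bin R M t = - M%:R * \sum_(j < t) sign_bin R M j.
Proof.
elim: t => [|t IHt]; first by rewrite big_ord0 mul0r mulr0.
have binS : t.+1%:R * 'C(M, t.+1)%:R = (M%:R - t%:R) * 'C(M, t)%:R :> R.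
  rewrite -natrM mul_bin_left; have [tM|Mt] := leqP t M.
    by rewrite natrM natrB.
  by rewrite bin_small // muln0 mulr0.
rewrite big_ord_recr /= mulrDr -IHt /sign_bin exprS.
transitivity (- (-1) ^+ t * (t.+1%:R * 'C(M, t.+1)%:R) : R); first by ring.
by rewrite binS; ring.
Qed.

Lemma sign_bin_small (R : pzRingType) (M j : nat) : (M < j)%N ->
  sign_bin R M j = 0.
Proof. by move=> Mj; rewrite /sign_bin bin_small // mulr0. Qed.

Lemma size_sub_comp_poly (R : idomainType) (q : {poly R}) (a : R) :
  (size (q - (q \Po ('X - a%:P)))%R <= (size q).-1)%N.
Proof.
have sX : size ('X - a%:P) = 2%N by rewrite size_XsubC.
have [->|q0] := eqVneq q 0; first by rewrite comp_poly0 subr0 size_poly0.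
have sq : size (q \Po ('X - a%:P)) = size q by apply: size_comp_poly2.
apply/leq_sizeP => j; rewrite leq_eqVlt => /orP[/eqP <-|qj]; rewrite coefB.
  have := lead_coef_comp q; rewrite /lead_coef.
  move=> /(_ ('X - a%:P)); rewrite sX sq coefB coefX coefC /=
    subr0 expr1n mulr1.
  by move=> ->; rewrite ?sX // subrr.
have sj : (size q <= j)%N by move: qj; case: (size q).
by rewrite (nth_default _ sj) nth_default ?subrr // sq.
Qed.

(** The N-th difference of a polynomial of degree less than N is 0, since each
    difference lowers the degree. *)
Lemma finite_difference (R : idomainType) (N : nat) (q : {poly R}) (x : R) :
  (size q <= N)%N -> \sum_(j < N.+1) sign_bin R N j * q.[x - j%:R] = 0.
Proof.
elim: N q => [|N IHN] q qN.
  by move: qN; rewrite leqn0 size_poly_eq0 => /eqP->; rewrite big1 // => j _;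
    rewrite horner0 mulr0.
rewrite -[RHS](IHN (q - (q \Po ('X - 1%:P)))); last first.
  by rewrite (leq_trans (size_sub_comp_poly _ _)) //; move: qN; case: (size q).
under [RHS]eq_bigr do rewrite hornerD hornerN horner_comp hornerXsubC mulrBr
  -addrA -opprD natr1.
rewrite sumrB [in RHS](_ : \sum_(j < N.+1) _ = \sum_(j < N.+2) sign_bin R N j
  * q.[x - j%:R]); last first.
  by rewrite [RHS]big_ord_recr /= sign_bin_small // mul0r addr0.
rewrite big_ord_recl [in RHS]big_ord_recl -addrA -sumrB.
congr (_ + _); first by rewrite /sign_bin !bin0.
apply: eq_bigr => j _; rewrite /sign_bin /= /bump leq0n add1n binS natrD exprS.
ring.
Qed.

(** * Exponentials of commuting operators *)

Section Exponential.

Variables (C : numClosedFieldType) (g : nat -> {linear Fock C -> Fock C}) (c :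
  C).
Hypothesis g_comm : forall i j v, g i (g j v) = g j (g i v).

Implicit Types (u v : Fock C).

Let F : op_series C := fun n v => if n == 0%N then 0 else (c / n%:R) *: g n v.
Let pow s := iter s (os_mul F) (@os_one C).
Let dF l v := if l == 0%N then 0 else c *: g l v.

(** The coefficients of exp (sum_(n > 0) (c / n) g_n w^n), indexed by integers
    so that recursions need no side condition on the sign of the index. *)
Definition exp_series : int -> Fock C -> Fock C := fun e v => coefz (os_exp F)
  e v.
Local Notation X := exp_series.

Let F_comm i j v : F i (F j v) = F j (F i v).
Proof.
rewrite /F; case: eqP => [_|_]; case: eqP => // _; rewrite ?linear0 ?scaler0 //.
by rewrite !linearZ /= g_comm !scalerA mulrC.
Qed.

Let natF l v : l%:R *: F l v = dF l v.
Proof.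
rewrite /F /dF; case: eqP => [->|/eqP l0]; first by rewrite scale0r.
by rewrite scalerA mulrC divfK // pnatr_eq0.
Qed.

Let F_dF_comm i j v : F i (dF j v) = dF j (F i v).
Proof.
rewrite -!natF F_comm; rewrite {2}/F /F; case: eqP => _; rewrite ?scaler0 //.
by rewrite linearZ /= !scalerA mulrC.
Qed.

Let F_sum i (I : Type) (r : seq I) (P : pred I) (G : I -> Fock C) :
  F i (\sum_(k <- r | P k) G k) = \sum_(k <- r | P k) F i (G k).
Proof.
rewrite /F; case: eqP => _; first by rewrite big1.
by rewrite linear_sum scaler_sumr.
Qed.

Let FZ i a v : F i (a *: v) = a *: F i v.
Proof.
rewrite /F; case: eqP => _; first by rewrite scaler0.
by rewrite linearZ /= !scalerA mulrC.
Qed.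

Let dF_sum i (I : Type) (r : seq I) (P : pred I) (G : I -> Fock C) :
  dF i (\sum_(k <- r | P k) G k) = \sum_(k <- r | P k) dF i (G k).
Proof.
rewrite /dF; case: eqP => _; first by rewrite big1.
by rewrite linear_sum scaler_sumr.
Qed.

Let dFZ i a v : dF i (a *: v) = a *: dF i v.
Proof.
rewrite /dF; case: eqP => _; first by rewrite scaler0.
by rewrite linearZ /= !scalerA mulrC.
Qed.

Let F0 i : F i 0 = 0.
Proof. by rewrite -(scale0r 0) FZ !scale0r. Qed.

Let pow_vanish s n v : (n < s)%N -> pow s n v = 0.
Proof.
elim: s n => // s IHs n ns; rewrite /pow iterS -/(pow s) /os_mul big1 // => i _.
have [->|i0] := posnP i; first by rewrite /F eqxx.
by rewrite (IHs (n - i)%N) ?F0 //; have := ltn_ord i; lia.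
Qed.

(** Leibniz rule for w d/dw: as the coefficients of f commute, the derivative
    of f^(s+1) is (s+1) f' f^s. *)
Let pow_euler s n v :
  n%:R *: pow s.+1 n v = s.+1%:R *: \sum_(l < n.+1) dF l (pow s (n - l)%N v).
Proof.
elim: s n => [|s IHs] n.
  rewrite scale1r /pow /= /os_mul scaler_sumr; apply: eq_bigr => l _.
  rewrite /os_one; have [nl|nl] := eqVneq (n - l)%N 0%N; last first.
    by rewrite F0 scaler0 -natF F0 scaler0.
  by rewrite -natF; congr (_%:R *: _); have := ltn_ord l; lia.
have -> : n%:R *: pow s.+2 n v = \sum_(l < n.+1) dF l (pow s.+1 (n - l)%N v)
    + \sum_(i < n.+1) F i ((n - i)%N%:R *: pow s.+1 (n - i)%N v).
  rewrite {1}/pow iterS -/(pow s.+1) /os_mul scaler_sumr -big_split.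
  apply: eq_bigr => i _; rewrite /= -natF FZ -scalerDl -natrD subnKC //.
  by rewrite -ltnS.
have -> : \sum_(i < n.+1) F i ((n - i)%N%:R *: pow s.+1 (n - i)%N v) =
    s.+1%:R *: \sum_(l < n.+1) dF l (pow s.+1 (n - l)%N v).
  transitivity (s.+1%:R *: \sum_(i < n.+1) \sum_(l < n.+1 | (i + l <= n)%N)
      F i (dF l (pow s (n - (i + l))%N v))).
    rewrite scaler_sumr; apply: eq_bigr => i _; rewrite IHs FZ F_sum.
    congr (_ *: _).
    have le : ((n - i).+1 <= n.+1)%N by rewrite ltnS leq_subr.
    rewrite (big_ord_widen _ (fun l => F i (dF l (pow s (n - i - l)%N v))) le).
    apply: eq_big => l; first by have := ltn_ord i; lia.
    by move=> _; rewrite subnDA.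
  congr (_ *: _); rewrite (exchange_big_dep xpredT) //.
  apply: eq_bigr => l _; rewrite /pow iterS -/(pow s) /os_mul dF_sum.
  have le : ((n - l).+1 <= n.+1)%N by rewrite ltnS leq_subr.
  rewrite [RHS](big_ord_widen _ (fun i => dF l (F i (pow s (n - l - i)%N v)))
    le).
  apply: eq_big => i; first by have := ltn_ord l; lia.
  by move=> _; rewrite F_dF_comm addnC subnDA.
by rewrite -{1}[X in X + _]scale1r -scalerDl -[1]/(1%:R) -natrD.
Qed.

Let os_exp_widen N n v : (n < N)%N ->
  os_exp F n v = \sum_(s < N) (s`!%:R)^-1 *: pow s n v.
Proof.
move=> nN; rewrite /os_exp.
rewrite (big_ord_widen N (fun s => (s`!%:R)^-1 *: pow s n v)) // big_mkcond.
apply: eq_bigr => s _; case: ltnP => // ns.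
by rewrite pow_vanish ?scaler0.
Qed.

Let os_exp_euler n v :
  n%:R *: os_exp F n v = \sum_(l < n.+1) dF l (os_exp F (n - l)%N v).
Proof.
have [->|n0] := posnP n.
  by rewrite scale0r big_ord1 /dF eqxx.
rewrite {1}/os_exp big_ord_recl scalerDr.
rewrite [X in n%:R *: X](_ : _ = 0) ?scaler0 ?add0r; last first.
  by rewrite /pow /os_one /= gtn_eqF ?scaler0.
transitivity (\sum_(s < n) \sum_(l < n.+1) (s`!%:R)^-1 *: dF l
  (pow s (n - l)%N v)).
  rewrite scaler_sumr; apply: eq_bigr => s _.
  rewrite scalerA mulrC -scalerA pow_euler scalerA /= factS natrM invfM.
  by rewrite mulrAC mulVf ?pnatr_eq0 // mul1r scaler_sumr.
rewrite exchange_big; apply: eq_bigr => l _.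
have [->|l0] := posnP l.
  by rewrite big1 ?{2}/dF ?eqxx // => s _; rewrite /dF eqxx scaler0.
rewrite (os_exp_widen (N := n)) ?dF_sum; last by rewrite ltn_subrL l0 n0.
by apply: eq_bigr => s _; rewrite dFZ.
Qed.

Lemma exp_series_lt0 e v : e < 0 -> X e v = 0.
Proof. by case: e. Qed.

Lemma exp_series0 v : X 0 v = v.
Proof. by rewrite /X /= /os_exp big_ord1 /= invr1 scale1r. Qed.

(** The differential equation w X' = (w f') X of X = exp f. It determines X,
    and everything about X is deduced from it. Any bound N will do because the
    terms with l >= e vanish, so that the same N serves for all smaller
    indices. *)
Lemma exp_series_rec (N : nat) (e : int) v : e <= N%:Z ->
  e%:~R *: X e v = c *: \sum_(l < N) g l.+1 (X (e - l.+1%:Z) v).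
Proof.
have [e0|e0] := ltP e 0.
  rewrite exp_series_lt0 // scaler0 big1 ?scaler0 // => l _.
  by rewrite exp_series_lt0 ?linear0 //; lia.
case: e e0 => // n _ nN.
rewrite [X in _ *: X = _](_ : _ = os_exp F n v) // os_exp_euler big_ord_recl.
rewrite {1}/dF eqxx add0r scaler_sumr.
have nN' : (n <= N)%N by [].
rewrite (big_ord_widen N (fun i => dF i.+1 (os_exp F (n - i.+1)%N v)) nN').
rewrite big_mkcond; apply: eq_bigr => l _.
case: ltnP => [ln|nl]; last first.
  by rewrite exp_series_lt0 ?linear0 ?scaler0 //; lia.
by rewrite subzn.
Qed.

Lemma exp_series_ind (P : int -> Prop) :
  (forall e, e < 0 -> P e) -> P 0 ->
  (forall e, 0 < e -> (forall l : nat, P (e - l.+1%:Z)) -> P e) ->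
  forall e, P e.
Proof.
move=> Pneg P0 IH e.
have [M eM] : exists M : nat, e < M%:Z by exists (`|e|%N.+1); lia.
elim: M e eM => [|M IHM] e eM; first exact: Pneg.
have [e0|e0|->//] := ltgtP e 0; first exact: Pneg.
by apply: IH => // l; apply: IHM; lia.
Qed.

Lemma exp_series_eq (N : nat) e u v : 0 < e -> e <= N%:Z ->
  e%:~R *: u = c *: \sum_(l < N) g l.+1 (X (e - l.+1%:Z) v) -> u = X e v.
Proof.
move=> e0 eN; rewrite -exp_series_rec // => /(congr1 (fun w => e%:~R^-1 *: w)).
by rewrite !scalerA mulVf ?intr_eq0 ?gt_eqF // !scale1r.
Qed.

Lemma exp_series_is_linear e : linear (X e).
Proof.
move=> a u v; elim/exp_series_ind: e => [e e0||e e0 IH].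
- by rewrite !exp_series_lt0 // scaler0 addr0.
- by rewrite !exp_series0.
symmetry; apply: (@exp_series_eq `|e|%N); [by []|lia|].
rewrite scalerDr scalerA mulrC -scalerA !(@exp_series_rec `|e|%N); [|lia..].
rewrite scalerA mulrC -scalerA -scalerDr scaler_sumr -big_split.
by congr (_ *: _); apply: eq_bigr => l _ /=; rewrite IH linearP.
Qed.

(** If the commutators of A with the coefficients of f are scalars, then [A,
    exp f] = [A, f] exp f. *)
Lemma exp_series_commutator (A : {linear Fock C -> Fock C}) (k : C) (l0 : nat) :
  (forall l v, A (g l.+1 v) =
    g l.+1 (A v) + (if l == l0 then (k * l0.+1%:R) *: v else 0)) ->
  forall e v, A (X e v) = X e (A v) + (c * k) *: X (e - l0.+1%:Z) v.
Proof.
move=> Ag; elim/exp_series_ind => [e e0||e e0 IH] v.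
- by rewrite !exp_series_lt0 ?linear0 ?scaler0 ?addr0 //; lia.
- by rewrite !exp_series0 exp_series_lt0 ?scaler0 ?addr0.
pose N := (`|e|%N + l0.+1)%N; have eN : e <= N%:Z by rewrite /N; lia.
apply/eqP; rewrite -subr_eq; apply/eqP.
apply: (exp_series_eq e0 eN); rewrite scalerBr.
have l0N : (l0 < N)%N by rewrite /N; lia.
have -> : e%:~R *: A (X e v) = c *: \sum_(l < N) A (g l.+1 (X (e - l.+1%:Z) v)).
  by rewrite -linearZ /= (exp_series_rec v eN) linearZ linear_sum.
have -> : \sum_(l < N) A (g l.+1 (X (e - l.+1%:Z) v)) =
    \sum_(l < N) g l.+1 (X (e - l.+1%:Z) (A v)) +
    (c * k) *: \sum_(l < N) g l.+1 (X (e - l0.+1%:Z - l.+1%:Z) v) +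
    (k * l0.+1%:R) *: X (e - l0.+1%:Z) v.
  rewrite scaler_sumr -big_split /=.
  have -> : (k * l0.+1%:R) *: X (e - l0.+1%:Z) v = \sum_(l < N)
      (if l == Ordinal l0N then (k * l0.+1%:R) *: X (e - l0.+1%:Z) v else 0).
    by rewrite -big_mkcond big_pred1_eq.
  rewrite -big_split; apply: eq_bigr => l _ /=.
  rewrite Ag IH linearD linearZ /= (addrAC e); congr (_ + _).
  by rewrite -[l == Ordinal _]/(l == l0 :> nat); case: eqP => [->|].
have := @exp_series_rec N (e - l0.+1%:Z) v.
move=> /(_ _)/esym rec; rewrite !scalerDr.
have scaleC (w : Fock C) : c *: ((c * k) *: w) = (c * k) *: (c *: w).
  by rewrite !scalerA mulrC.
rewrite scaleC rec; last by rewrite /N; lia.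
rewrite !scalerA -!addrA -[RHS]addr0; congr (_ + _).
rewrite -scalerBl -scalerDl [X in X *: _](_ : _ = 0) ?scale0r //.
by rewrite intrB -pmulrn; ring.
Qed.

(** For A(z) = sum_n A_n z^-n the hypothesis says that [A(z), f(w)] is - c a
    log(1 - w/z) A(z), whence A(z) exp(f(w)) = (1 - w/z)^(- c a) exp(f(w))
    A(z). The recursion on d is the differential equation of d(t) = (1 - t)^(-
    c a). *)
Lemma exp_series_family (A : int -> {linear Fock C -> Fock C}) (a : C)
    (d : nat -> C) :
  (forall n l v, A n (g l.+1 v) = g l.+1 (A n v) + a *: A (n - l.+1%:Z) v) ->
  d 0%N = 1 -> (forall t, t%:R * d t = c * a * \sum_(j < t) d j) ->
  forall (N : nat) e n v, e < N%:Z ->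
  A n (X e v) = \sum_(j < N) d j *: X (e - j%:Z) (A (n - j%:Z) v).
Proof.
move=> Ag d0 drec N; elim/exp_series_ind => [e e0||e e0 IH] n v eN.
- rewrite exp_series_lt0 // linear0 big1 // => j _.
  by rewrite exp_series_lt0 ?scaler0 //; lia.
- case: N eN => // N _; rewrite big_ord_recl d0 scale1r !subr0 !exp_series0.
  by rewrite big1 ?addr0 // => j _; rewrite exp_series_lt0 ?scaler0.
pose Y t := X (e - t%:Z) (A (n - t%:Z) v).
have Y0 t : (N <= t)%N -> Y t = 0.
  by move=> Nt; rewrite /Y exp_series_lt0 //; lia.
have eN' : e <= N%:Z by exact: ltW.
suff : e%:~R *: A n (X e v) = e%:~R *: \sum_(j < N) d j *: Y j.
  move=> /(congr1 (fun w => e%:~R^-1 *: w)).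
  by rewrite !scalerA mulVf ?intr_eq0 ?gt_eqF // !scale1r.
have -> : e%:~R *: A n (X e v) =
  c *: \sum_(l < N) A n (g l.+1 (X (e - l.+1%:Z) v)).
  by rewrite -linearZ /= (exp_series_rec v eN') linearZ linear_sum.
have -> : \sum_(l < N) A n (g l.+1 (X (e - l.+1%:Z) v)) =
    \sum_(j < N) d j *: \sum_(l < N)
       g l.+1 (X (e - j%:Z - l.+1%:Z) (A (n - j%:Z) v)) +
    a *: \sum_(l < N) \sum_(j < N) d j *: Y (l + j.+1)%N.
  have IH' l k w : A k (X (e - l.+1%:Z) w) =
      \sum_(j < N) d j *: X (e - l.+1%:Z - j%:Z) (A (k - j%:Z) w).
    by apply: IH; lia.
  under eq_bigr do rewrite Ag.
  rewrite big_split /= -scaler_sumr; congr (_ + _ *: _).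
    under eq_bigr do rewrite IH' linear_sum.
    rewrite exchange_big /=; apply: eq_bigr => j _; rewrite scaler_sumr.
    by apply: eq_bigr => l _; rewrite linearZ /= (addrAC e).
  apply: eq_bigr => l _; rewrite IH'; apply: eq_bigr => j _; rewrite /Y.
  by rewrite -!addrA -!opprD -PoszD addSnnS.
have -> : \sum_(l < N) \sum_(j < N) d j *: Y (l + j.+1)%N =
    \sum_(t < N) (\sum_(j < t) d j) *: Y t.
  rewrite exchange_big /=.
  under eq_bigr do rewrite -scaler_sumr sum_shift // scaler_sumr.
  rewrite (exchange_big_dep xpredT) //=; apply: eq_bigr => t _.
  rewrite -scaler_suml (big_ord_widen N d) ?(ltnW (ltn_ord t)) //.
rewrite scalerDr scalerA !scaler_sumr -big_split; apply: eq_bigr => t _ /=.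
have -> :
  c *: (d t *: \sum_(l < N) g l.+1 (X (e - t%:Z - l.+1%:Z) (A (n - t%:Z) v)))
   = (d t * (e - t%:Z)%:~R) *: Y t.
  transitivity (d t *: (c *: \sum_(l < N)
    g l.+1 (X (e - t%:Z - l.+1%:Z) (A (n - t%:Z) v)))).
    by rewrite !scalerA [c * _]mulrC.
  rewrite -(@exp_series_rec N (e - t%:Z)) ?scalerA //.
  by rewrite (le_trans _ eN') // lerBlDr lerDl.
rewrite !scalerA -drec -scalerDl; congr (_ *: _).
by rewrite intrB -pmulrn; ring.
Qed.

End Exponential.

(** * Commutators with the Heisenberg algebra *)

Section Commutators.

Variables (C : numClosedFieldType) (m : nat).
Implicit Types (u v : Fock C) (k n : int).

Local Notation fvec := (fvec C).
Local Notation s := (sqrt2m C m).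
Local Notation heis := (@heis C m).
Local Notation vop := (@vop C m).
Local Notation T := (@shiftT C m).

Definition creation (n : nat) : {linear Fock C -> Fock C} := heis (- n%:Z).

Definition annihilation (n : nat) : {linear Fock C -> Fock C} := heis n%:Z.

Definition expz_minus (e : int) v := coefz (exp_minus m) e v.

Definition expz_plus (e : int) v := coefz (exp_plus m) e v.

#[global] Arguments expz_minus : simpl never.
#[global] Arguments expz_plus : simpl never.

Lemma creation_comm i j v : creation i (creation j v) =
  creation j (creation i v).
Proof.
apply/eqP; rewrite -subr_eq0 heis_comm.
case: ifP => [/eqP ij|_]; last by rewrite scale0r.
by rewrite (_ : - i%:Z = 0) ?mulr0z ?scale0r //; lia.
Qed.

Lemma annihilation_comm i j v : annihilation i (annihilation j v) =
  annihilation j (annihilation i v).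
Proof.
apply/eqP; rewrite -subr_eq0 heis_comm.
case: ifP => [/eqP ij|_]; last by rewrite scale0r.
by rewrite (_ : i = 0%N) ?mulr0z ?scale0r //; lia.
Qed.

Lemma expz_minusE e v : expz_minus e v = exp_series creation s e v.
Proof. by []. Qed.

Lemma expz_plusE e v : expz_plus e v = exp_series annihilation (- s) e v.
Proof.
rewrite /expz_plus /exp_series; congr coefz; congr os_exp.
by do 2!(apply/funext => ?); rewrite mulNr.
Qed.

Lemma expz_minus_is_linear e : linear (expz_minus e).
Proof.
by move=> a u v; rewrite !expz_minusE; apply: exp_series_is_linear
  creation_comm _ _ _ _.
Qed.

Lemma expz_plus_is_linear e : linear (expz_plus e).
Proof.
by move=> a u v; rewrite !expz_plusE; apply: exp_series_is_linear
  annihilation_comm _ _ _ _.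
Qed.

HB.instance Definition _ e :=
  GRing.isLinear.Build C (Fock C) (Fock C) *:%R (expz_minus e)
    (expz_minus_is_linear e).
HB.instance Definition _ e :=
  GRing.isLinear.Build C (Fock C) (Fock C) *:%R (expz_plus e)
    (expz_plus_is_linear e).

Lemma expz_minus_lt0 e v : e < 0 -> expz_minus e v = 0.
Proof. by case: e. Qed.

Lemma expz_plus_lt0 e v : e < 0 -> expz_plus e v = 0.
Proof. by case: e. Qed.

Lemma expz_minus0 v : expz_minus 0 v = v.
Proof. exact: exp_series0. Qed.

Lemma heis_swap i j v : heis i (heis j v) =
  heis j (heis i v) + (if i + j == 0 then i%:~R else 0) *: v.
Proof. by rewrite -(@heis_comm C m) addrC subrK. Qed.

Lemma heis_expz_minus (l : nat) e v :
  heis l.+1 (expz_minus e v) = expz_minus e (heis l.+1 v) +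
    s *: expz_minus (e - l.+1%:Z) v.
Proof.
rewrite !expz_minusE; have := @exp_series_commutator C creation s creation_comm
  (heis l.+1) 1 l _ e v.
rewrite mulr1; apply=> i w; rewrite /creation /= heis_swap mul1r; congr (_ + _).
rewrite subr_eq0 eqz_nat eqSS eq_sym.
by case: eqP; rewrite ?scale0r.
Qed.

Lemma heisN_expz_plus (l : nat) e v : heis (- l.+1%:Z) (expz_plus e v) =
  expz_plus e (heis (- l.+1%:Z) v) + s *: expz_plus (e - l.+1%:Z) v.
Proof.
rewrite !expz_plusE.
have := @exp_series_commutator C annihilation (- s) annihilation_comm
  (heis (- l.+1%:Z)) (-1) l _ e v.
rewrite mulrN1 opprK; apply=> i w; rewrite /annihilation /= heis_swap mulN1r;
  congr (_ + _).
rewrite addrC subr_eq0 eqz_nat eqSS.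
by case: eqP; rewrite ?scale0r // mulrNz.
Qed.

Lemma heis_expz_plus (l : nat) e v : heis l (expz_plus e v) =
  expz_plus e (heis l v).
Proof.
rewrite !expz_plusE.
have := @exp_series_commutator C annihilation (- s) annihilation_comm (heis l)
  0 0 _ e v.
rewrite mulr0 scale0r addr0; apply=> i w.
rewrite /annihilation /= heis_swap mul0r scale0r if_same addr0.
by case: eqP => [|_]; [lia|rewrite scale0r addr0].
Qed.

Lemma heisN_expz_minus (l : nat) e v : heis (- l%:Z) (expz_minus e v) =
  expz_minus e (heis (- l%:Z) v).
Proof.
rewrite !expz_minusE.
have := @exp_series_commutator C creation s creation_comm (heis (- l%:Z)) 0 0 _
  e v.
rewrite mulr0 scale0r addr0; apply=> i w.
rewrite /creation /= heis_swap mul0r scale0r if_same addr0.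
by case: eqP => [|_]; [lia|rewrite scale0r addr0].
Qed.

Lemma vop_fvecE n k mu N : (wdeg mu <= N)%N ->
  vop n (fvec k mu) =
  \sum_(j < N.+1) expz_minus (j%:Z - k - n - 1) (expz_plus j (T (fvec k mu))).
Proof. exact: vopE. Qed.

Lemma wdeg_divX mu i : (wdeg (divX mu i) <= wdeg mu)%N.
Proof.
have [mui|mui] := eqVneq (mu i) 0%N; last first.
  by rewrite -{2}(divXK mui) wdegX leq_addr.
suff -> : divX mu i = mu by [].
by apply/eqP/cmP => j; rewrite divXE; case: eqP => [<-|]; rewrite ?mui ?subn0.
Qed.

(** In each range of l a single factor of the vertex operator fails to commute
    with h_l, namely exp_minus for l > 0, exp_plus for l < 0 and T for l = 0,
    and in all cases the commutator of h_l and a_n is sqrt(2m) a_(n+l). *)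
Lemma heis_vop_pos (l : nat) n v : heis l.+1 (vop n v) =
  vop n (heis l.+1 v) + s *: vop (n + l.+1%:Z) v.
Proof.
pose f : {linear Fock C -> Fock C} := heis l.+1 \o vop n.
pose g : {linear Fock C -> Fock C} :=
  (vop n \o heis l.+1) \+ (s \*: vop (n + l.+1%:Z)).
suff : f =1 g by apply.
apply: linear_eq => k mu; rewrite /f /g /= {f g}.
rewrite heis_posE [vop n (_ *: _)]linearZ /= !(@vop_fvecE _ _ _ (wdeg mu))
  ?wdeg_divX //.
rewrite linear_sum !scaler_sumr -big_split; apply: eq_bigr => j _ /=.
rewrite heis_expz_minus heis_expz_plus -shiftT_heis // heis_posE !linearZ /=.
by congr (_ + _ *: expz_minus _ _); lia.
Qed.

Lemma heis_vop_neg (l : nat) n v : vop n (heis (- l.+1%:Z) v) =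
  heis (- l.+1%:Z) (vop n v) + (- s) *: vop (n - l.+1%:Z) v.
Proof.
pose f : {linear Fock C -> Fock C} := vop n \o heis (- l.+1%:Z).
pose g : {linear Fock C -> Fock C} :=
  (heis (- l.+1%:Z) \o vop n) \+ ((- s) \*: vop (n - l.+1%:Z)).
suff : f =1 g by apply.
apply: linear_eq => k mu; rewrite /f /g /= {f g}.
pose N := (wdeg mu + l.+1)%N.
have -> : heis (- l.+1%:Z) (fvec k mu) = fvec k (mulX mu l).
  by rewrite -NegzE heis_negE.
rewrite (@vop_fvecE n k (mulX mu l) N) ?wdegX // (@vop_fvecE n _ _ N)
  ?leq_addr //.
rewrite (@vop_fvecE _ k mu (wdeg mu)) // linear_sum /=.
have -> : \sum_(j < (wdeg mu).+1)
    expz_minus (j%:Z - k - (n - l.+1%:Z) - 1) (expz_plus j (T (fvec k mu))) =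
  \sum_(j < N.+1) expz_minus (j%:Z - k - n - 1) (expz_plus (j%:Z - l.+1%:Z)
    (T (fvec k mu))).
  rewrite /N -addSn addnC big_split_ord /= [X in _ = X + _]big1 ?add0r =>
    [|j _].
    apply: eq_bigr => j _; congr (expz_minus _ (expz_plus _ _)); lia.
  by rewrite expz_plus_lt0 ?linear0 //; have := ltn_ord j; lia.
rewrite scaler_sumr -big_split; apply: eq_bigr => j _ /=.
rewrite heisN_expz_minus heisN_expz_plus -shiftT_heis // -NegzE heis_negE.
by rewrite linearD linearZ /= scaleNr addrK.
Qed.

Lemma heis0_vop n v : (0 < m)%N -> heis 0 (vop n v) =
  vop n (heis 0 v) + s *: vop n v.
Proof.
move=> m0; pose f : {linear Fock C -> Fock C} := heis 0 \o vop n.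
pose g : {linear Fock C -> Fock C} := (vop n \o heis 0) \+ (s \*: vop n).
suff : f =1 g by apply.
apply: linear_eq => k mu; rewrite /f /g /= {f g}.
rewrite heis0E [vop n (_ *: _)]linearZ /= (@vop_fvecE _ _ _ (wdeg mu)) //.
rewrite linear_sum !scaler_sumr -big_split; apply: eq_bigr => j _ /=.
rewrite -[heis 0]/(heis (- 0%:Z)) heisN_expz_minus -[heis (- 0%:Z)]/(heis 0%:Z)
  heis_expz_plus heis0_shiftT // heis0E.
by rewrite -scalerDl !linearZ /= scalerDl.
Qed.

End Commutators.

(** * Products of two vertex operators *)

Section Locality.

Variables (C : numClosedFieldType) (m : nat).
Implicit Types (u v : Fock C) (k n : int).

Local Notation fvec := (fvec C).
Local Notation s := (sqrt2m C m).
Local Notation heis := (@heis C m).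
Local Notation vop := (@vop C m).
Local Notation vp := (@vp C).
Local Notation expz_minus := (@expz_minus C m).
Local Notation word := (@vop_word C m).
Local Notation d := (sign_bin C (2 * m)).

Lemma sqrt2mM : s * s = (2 * m)%:R.
Proof. by rewrite -expr2 sqrtCK. Qed.

(** Moving phi(z) past exp_minus(w) costs the factor (1 - w/z)^(2m). *)
Lemma vop_expz_minus n e v :
  vop n (expz_minus e v) = \sum_(j < (2 * m).+1) d j *: expz_minus (e - j%:Z)
    (vop (n - j%:Z) v).
Proof.
pose N := (`|e|%N + (2 * m).+1)%N.
have -> : vop n (expz_minus e v) = \sum_(j < N) d j *: expz_minus (e - j%:Z)
  (vop (n - j%:Z) v).
  apply: (@exp_series_family C (creation C m) s (@creation_comm C m) vop (- s)
    d).
  - by move=> k l w; exact: heis_vop_neg.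
  - by rewrite /sign_bin bin0 mulr1.
  - by move=> t; rewrite sign_bin_rec mulrN sqrt2mM.
  - by rewrite /N; lia.
have le : ((2 * m).+1 <= N)%N by rewrite leq_addl.
rewrite [RHS](big_ord_widen N (fun j => d j *: expz_minus (e - j%:Z)
  (vop (n - j%:Z) v)) le).
rewrite [RHS]big_mkcond; apply: eq_bigr => j _.
by case: ltnP => // /sign_bin_small ->; rewrite scale0r.
Qed.

Lemma expz_minus_comm a b v : expz_minus a (expz_minus b v) =
  expz_minus b (expz_minus a v).
Proof.
rewrite !(@expz_minusE _ _ b).
have := @exp_series_commutator C (creation C m) s (@creation_comm C m)
  (expz_minus a) 0 0 _ b v.
rewrite mulr0 scale0r addr0; apply=> i w.
by rewrite /creation /= heisN_expz_minus mul0r scale0r if_same addr0.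
Qed.

Lemma vop_vp_expz p (i : int) : vop (p - 1 - i) (vp p) =
  expz_minus i (vp (p - (2 * m)%:Z)).
Proof.
rewrite (@vopE _ _ _ _ _ 0%N); last by rewrite /wdeg mdom1 big_seq_fset0.
rewrite big_ord1 /vop_term shiftTE.
have -> : 0%N%:Z - - p - (p - 1 - i) - 1 = i by lia.
rewrite -/(expz_minus i _) -[exp_plus m 0 _]/(expz_plus m 0 _) expz_plusE
  exp_series0 /vp /hwv.
by rewrite opprB addrC.
Qed.

(** Up to a power of z w, the series phi(z) phi(w) v_p is (z - w)^(2m) X(z)
    X(w) v, where X = exp_minus and v is a highest weight vector. As X(z) X(w)
    is symmetric, both the commutativity and the quadratic relations follow
    from this formula. *)
Lemma vop_vop_vp p (a b : int) :
  vop (p - 1 - a) (vop (p - 1 - b) (vp p)) = \sum_(j < (2 * m).+1)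
    d j *: expz_minus (b - j%:Z) (expz_minus (a + j%:Z - (2 * m)%:Z)
      (vp (p - (4 * m)%:Z))).
Proof.
rewrite vop_vp_expz vop_expz_minus; apply: eq_bigr => j _;
  congr (_ *: expz_minus _ _).
have -> : p - 1 - a - j%:Z = (p - (2 * m)%:Z) - 1 - (a + j%:Z - (2 * m)%:Z)
  by lia.
by rewrite vop_vp_expz; congr (expz_minus _ (vp _)); lia.
Qed.

Lemma vop_comm_vp p n r : vop n (vop r (vp p)) = vop r (vop n (vp p)).
Proof.
have -> : n = p - 1 - (p - 1 - n) by lia.
have -> : r = p - 1 - (p - 1 - r) by lia.
(* (z - w)^(2m) is symmetric: the terms j and 2m - j are exchanged. *)
rewrite !vop_vop_vp [RHS](reindex_inj rev_ord_inj) /=; apply: eq_bigr => j _.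
have jm := ltn_ord j; rewrite subSS expz_minus_comm /sign_bin bin_sub //.
congr (_ *: expz_minus _ (expz_minus _ _)); try lia.
have : ~~ odd (2 * m) by lia.
rewrite -{1}(subnK (_ : j <= 2 * m)%N) // oddD => oj.
by rewrite -[in LHS]signr_odd -[in RHS]signr_odd; move: oj; do 2!case: odd.
Qed.

Lemma cmonom_ind (P : {cmonom nat} -> Prop) :
  P (onecm nat) -> (forall mu i, P mu -> P (mulX mu i)) -> forall mu, P mu.
Proof.
move=> P1 PX mu.
elim/ltn_ind: {mu}(wdeg mu) {-2}mu (erefl (wdeg mu)) => w IH mu muw.
have [mu1|[i mui]] : mu = onecm nat \/ exists i, mu i != 0%N.
  have [mu0|/fset0Pn[i imu]] := eqVneq (finsupp mu) fset0; last first.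
    by right; exists i; rewrite cmE_neq0.
  by left; apply/eqP/cmP => j; apply/eqP; rewrite onecmE cmE_eq0 mu0 in_fset0.
  by rewrite mu1.
rewrite -(divXK mui); apply/PX/(IH (wdeg (divX mu i))) => //.
by rewrite -muw -{2}(divXK mui) wdegX; lia.
Qed.

(** The commutator of [a_n, a_r] with h_(-l) is a combination of commutators
    [a_n', a_r'], and the h_(-l) generate the Fock space from the highest
    weight vectors, on which [a_n, a_r] = 0. *)
Lemma vop_comm n r v : vop n (vop r v) = vop r (vop n v).
Proof.
pose f (x y : int) : {linear Fock C -> Fock C} := vop x \o vop y.
apply: (linear_eq (f := f n r) (g := f r n)) => k mu; rewrite /f /= {f v}.
elim/cmonom_ind: mu n r => [|mu i IH] n r.
  by rewrite -[k]opprK -/(hwv C (- - k)) -/(vp (- k)) vop_comm_vp.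
have -> : fvec k (mulX mu i) = heis (- i.+1%:Z) (fvec k mu).
  by rewrite -NegzE heis_negE.
rewrite !heis_vop_neg !linearD !linearZ /= !heis_vop_neg.
rewrite (IH n r) (IH (n - i.+1%:Z) r) (IH n (r - i.+1%:Z)).
by rewrite addrAC.
Qed.

(** By vop_vop_vp the sum pairs the values of q with the coefficients of (z -
    w)^(2m): it is a combination of differences of order 2m of q. *)
Lemma vop_quad (q : {poly C}) (n : nat) p : (size q <= 2 * m)%N ->
  \sum_(x < n.+1) q.[x%:R] *: vop (p - 1 - x%:Z) (vop (p - 1 - (n%:Z - x%:Z))
    (vp p)) = 0.
Proof.
move=> qm; pose y t : Fock C :=
  expz_minus (n%:Z - t%:Z) (expz_minus (t%:Z - (2 * m)%:Z)
  (vp (p - (4 * m)%:Z))).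
have y0 t : (n.+1 <= t)%N -> y t = 0 by move=> nt;
  rewrite /y expz_minus_lt0 //; lia.
transitivity (\sum_(j < (2 * m).+1) d j *: \sum_(x < n.+1)
  q.[x%:R] *: y (x + j)%N).
  under [RHS]eq_bigr do rewrite scaler_sumr.
  rewrite [RHS]exchange_big; apply: eq_bigr => x _ /=.
  rewrite vop_vop_vp scaler_sumr; apply: eq_bigr => j _.
  rewrite !scalerA mulrC; congr (_ *: expz_minus _ (expz_minus _ _)); lia.
transitivity (\sum_(j < (2 * m).+1) d j *: \sum_(t < n.+1)
  q.[t%:R - j%:R] *: y t).
  apply: eq_bigr => j _; congr (_ *: _).
  pose F t := q.[t%:R - j%:R] *: y t.
  transitivity (\sum_(x < n.+1) F (x + j)%N).
    by apply: eq_bigr => x _; rewrite /F natrD addrK.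
  rewrite sum_shift => [|t nt]; last by rewrite /F y0 ?scaler0.
  rewrite big_mkcond; apply: eq_bigr => t _ /=.
  case: leqP => // tj; rewrite /y [expz_minus (_ - (2 * m)%:Z) _]expz_minus_lt0
    ?linear0 ?scaler0 //.
  by have := ltn_ord j; lia.
under eq_bigr do rewrite scaler_sumr.
rewrite exchange_big big1 //= => t _.
under eq_bigr do rewrite scalerA.
by rewrite -scaler_suml finite_difference // scale0r.
Qed.

(** * Lowering all indices of a product *)

(** The coefficients of G(z) = exp (- (2m)^(-1/2) sum_(n > 0) (h_n / n) z^-n).
    The constant is chosen so that G(z) phi(w) = (1 - w/z) phi(w) G(z), a
    linear factor. *)
Definition lowering (e : int) v := exp_series (annihilation C m) (- s^-1) e v.

#[global] Arguments lowering : simpl never.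

Lemma lowering_is_linear e : linear (lowering e).
Proof.
by move=> a u v; apply: exp_series_is_linear (@annihilation_comm C m) _ _ _ _.
Qed.

HB.instance Definition _ e :=
  GRing.isLinear.Build C (Fock C) (Fock C) *:%R (lowering e)
    (lowering_is_linear e).

(** exp_series_family gives the equivalent relation phi(w) G(z) = (1 - w/z)^-1
    G(z) phi(w), in which all the coefficients are 1. *)
Lemma lowering_vop (n : int) j v : (0 < m)%N ->
  lowering n (vop j v) = vop j (lowering n v) - vop (j + 1)
    (lowering (n - 1) v).
Proof.
move=> m0; have sN0 := sqrt2m_neq0 C m0.
have key (N : nat) k e : e < N%:Z ->
    vop k (lowering e v) = \sum_(i < N) lowering (e - i%:Z) (vop (k + i%:Z) v).
  move=> eN; have := @exp_series_family C (annihilation C m) (- s^-1)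
    (@annihilation_comm C m)
    (fun k => vop (- k)) (- s) (fun=> 1) _ _ _ N e (- k) v eN.
  rewrite opprK => -> //.
  - by apply: eq_bigr => i _; rewrite scale1r /lowering;
    congr (exp_series _ _ _ (vop _ _)); lia.
  - move=> i l w; rewrite /annihilation /= heis_vop_pos scaleNr.
    by rewrite (_ : - (i - l.+1%:Z) = - i + l.+1%:Z) ?addrK //; lia.
  - by move=> t; rewrite mulrNN mulVf // mul1r mulr1 sumr_const card_ord.
pose N := `|n|%N.+1.
rewrite (key N.+1 j n) ?(key N (j + 1) (n - 1)); [|rewrite /N; lia..].
rewrite big_ord_recl subr0 addr0 -addrA -sumrB big1 ?addr0 // => i _.
apply/eqP; rewrite subr_eq0; apply/eqP.
by congr (lowering _ (vop _ _)); rewrite lift0; lia.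
Qed.

Lemma lowering_vp (e : int) p : 0 < e -> lowering e (vp p) = 0.
Proof.
move=> e0; have eN : e <= `|e|%N%:Z by lia.
have := @exp_series_rec C (annihilation C m) (- s^-1) (@annihilation_comm C m)
  `|e| e (vp p) eN.
rewrite big1 ?scaler0 => [/eqP|l _].
  by rewrite scaler_eq0 intr_eq0 gt_eqF //= => /eqP.
have := @exp_series_commutator C (annihilation C m) (- s^-1)
  (@annihilation_comm C m)
  (heis l.+1) 0 0 _ (e - l.+1%:Z) (vp p).
rewrite mulr0 scale0r addr0 => ->.
  transitivity (lowering (e - l.+1%:Z) 0); last exact: linear0.
  by congr exp_series; exact: heis_hwv.
move=> i w; rewrite -/(annihilation C m l.+1 _) annihilation_comm mul0r scale0r
  if_same addr0 //.
Qed.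

Lemma lowering_word_vanish p (js : seq int) (e : int) : (0 < m)%N ->
  (size js)%:Z < e -> lowering e (word p js) = 0.
Proof.
move=> m0; elim: js e => [|j js IH] e je /=; first exact: lowering_vp.
by rewrite lowering_vop // !IH ?[vop _ 0]linear0 ?subrr //; move: je => /=; lia.
Qed.

(** On a product of L vertex operators G(z) creates prod_i (1 - w_i/z), whose
    coefficient of z^-L is (-1)^L w_1 ... w_L: multiplication by it shifts
    every index by one. *)
Lemma lowering_word p (js : seq int) : (0 < m)%N ->
  lowering (size js) (word p js) =
    (-1) ^+ size js *: word p (map (fun j => j + 1) js).
Proof.
move=> m0; elim: js => [|j js IH] /=.
  by rewrite scale1r; exact: exp_series0.
rewrite lowering_vop // lowering_word_vanish ?linear0 ?sub0r //; last by lia.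
have -> : (size js).+1%:Z - 1 = size js by lia.
by rewrite IH linearZ /= exprS mulN1r scaleNr.
Qed.

End Locality.

(** * Linear independence of products with gaps *)

Section Independence.

Variables (C : numClosedFieldType) (m : nat).
Hypothesis m_gt0 : (0 < m)%N.
Implicit Types (u v : Fock C) (k n p : int) (t : seq nat).

Local Notation s := (sqrt2m C m).
Local Notation heis := (@heis C m).
Local Notation vop := (@vop C m).
Local Notation vp := (@vp C).
Local Notation word := (@vop_word C m).

Lemma foldr_vop_swap v j l r : foldr vop v (l ++ j :: r) =
  vop j (foldr vop v (l ++ r)).
Proof. by elim: l => //= i l ->; rewrite vop_comm. Qed.

Lemma word_perm p js js' : perm_eq js js' -> word p js = word p js'.
Proof.
elim: js js' => [|j js IH] js'; first by rewrite perm_sym => /perm_nilP->.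
move=> pjs; have jjs' : j \in js' by rewrite -(perm_mem pjs) mem_head.
case/splitPr: jjs' pjs => l r pjs; rewrite /vop_word foldr_vop_swap /=.
congr (vop j _); apply: IH; rewrite -(perm_cons j) (perm_trans pjs) //.
by rewrite perm_catC /= perm_cons perm_catC.
Qed.

Lemma word_cons_last p j js : word p (j :: js) = foldr vop (vop j (vp p)) js.
Proof.
by rewrite (@word_perm _ _ (rcons js j)) ?[perm_eq (_ :: _) _]perm_sym
  ?perm_rcons // /vop_word foldr_rcons.
Qed.

Lemma word_vanish p j js : j \in js -> p <= j -> word p js = 0.
Proof.
move=> /perm_to_rem/word_perm-> pj; rewrite word_cons_last vop_vp //.
by elim: (rem j js) => //= i l ->; rewrite linear0.
Qed.

(** In the numbering by i = p - 1 - j, the operators a_j that may act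
    nontrivially on v_p are those with i >= 0. *)
Definition bword p t : Fock C := word p [seq p - 1 - i%:Z | i <- t].

(** 2m is the order of vanishing of phi(z) phi(w) at z = w. *)
Definition gap : rel nat := fun a b => (a + 2 * m <= b)%N.

Lemma gap_trans : transitive gap.
Proof. by move=> b a c; rewrite /gap; lia. Qed.

(** As a_(p-1) v_p = v_(p-2m), the factor of index 0 is absorbed by the vector,
    with respect to which the other indices decrease by 2m. *)
Lemma bword0 p t : all (leq (2 * m)) t ->
  bword p (0%N :: t) = bword (p - (2 * m)%:Z) [seq (i - 2 * m)%N | i <- t].
Proof.
move=> tm; rewrite /bword [map _ (_ :: _)]/=
  word_cons_last vop_vp_expz expz_minus0.
rewrite -map_comp /vop_word; congr foldr; apply/eq_in_map => i it /=.
by have := allP tm i it; lia.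
Qed.

(** The index 0 is lowered to that of a_p, which kills v_p. *)
Lemma lowering_bword p t : sorted gap t -> lowering m (size t) (bword p t) =
  if head 0%N t == 0%N then (if t is [::] then bword p t else 0)
  else (-1) ^+ size t *: bword p (map predn t).
Proof.
move=> st; rewrite /bword.
have := @lowering_word C m p [seq p - 1 - i%:Z | i <- t] m_gt0;
  rewrite size_map => ->.
case: t st => [|[|i] t] st; first by rewrite scale1r.
  rewrite (@word_vanish _ p) ?scaler0 ?lexx // -map_comp inE /=.
  by rewrite subr0 subrK eqxx.
rewrite [head _ _ == _]/=; congr (_ *: word p _).
rewrite -!map_comp /=; congr (_ :: _); first by lia.
apply/eq_in_map => j jt /=.
have /allP/(_ j jt) := order_path_min gap_trans st.
by rewrite /gap; lia.
Qed.

Lemma vp_neq0 p : vp p != 0.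
Proof.
apply/eqP => /(congr1 (coeff (- p, onecm nat))) /eqP.
by rewrite coeff0 /vp /hwv fvec.unlock coeffU eqxx mulr1 oner_eq0.
Qed.

Lemma sum_filter (I : eqType) (V : nmodType) (r : seq I) (P : pred I) (F : I ->
  V) :
  {in r, forall i, ~~ P i -> F i = 0} ->
  \sum_(i <- r) F i = \sum_(i <- filter P r) F i.
Proof.
move=> F0; rewrite big_filter [RHS]big_mkcond; apply: eq_big_seq => i ir.
by case: ifPn => // /(F0 i ir).
Qed.

Definition free_on (p : int) (S : seq (seq nat)) := forall c : seq nat -> C,
  \sum_(t <- S) c t *: bword p t = 0 -> {in S, forall t, c t = 0}.

Lemma map_subnK (k : nat) t : all (leq k) t ->
  map (addn k) (map (subn^~ k) t) = t.
Proof.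
move=> tk; rewrite -map_comp -[RHS]map_id; apply/eq_in_map => i it /=.
by rewrite subnKC // (allP tk).
Qed.

Lemma gap_map_subn (k : nat) t : all (leq k) t -> sorted gap t ->
  sorted gap (map (subn^~ k) t).
Proof.
move=> tk; rewrite sorted_map; apply: (sub_in_sorted _ tk) => a b.
by rewrite -!topredE /gap /=; lia.
Qed.

(** Induction on the length, then on a bound for the smallest index. Lowering a
    relation removes the products that contain the index 0 and decreases the
    indices of the others, whose coefficients are therefore 0. In what remains
    all products contain the index 0, and bword0 reduces their length. *)
Lemma bword_free_size L p S : uniq S ->
  {in S, forall t, sorted gap t /\ size t = L} -> free_on p S.
Proof.
elim: L p S => [|L IHL] p S uS S_gap.
  move=> c cS t tS; have t0 := size0nil (S_gap _ tS).2.
  have S1 : perm_eq S [:: t].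
    apply: uniq_perm => // x; rewrite inE; apply/idP/eqP => [xS|->//].
    by rewrite t0 (size0nil (S_gap _ xS).2).
  have /eqP := cS; rewrite (perm_big _ S1) big_seq1 t0 scaler_eq0.
  by rewrite (negPf (vp_neq0 p)) orbF => /eqP.
have [M SM] : exists M, {in S, forall t, head 0%N t < M}%N.
  exists (\sum_(t <- S) head 0%N t).+1 => t tS.
  by rewrite ltnS (big_rem t) //= leq_addr.
elim: M S uS S_gap SM => [|M IHM] S uS S_gap SM c cS; first by move=> t /SM.
have cpos t : t \in S -> (0 < head 0 t)%N -> c t = 0.
  pose S' := map (map predn) (filter (fun t => 0 < head 0 t)%N S).
  have pos x : x \in filter (fun t => 0 < head 0 t)%N S -> all (leq 1) x.
    rewrite mem_filter => /andP[x0 /S_gap[]]; case: x x0 => //= i x i0 sx _.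
    rewrite i0 /=; apply: sub_all (order_path_min gap_trans sx) => j.
    by rewrite /gap; lia.
  have predE x : map predn x = map (subn^~ 1%N) x by apply: eq_map => i;
    rewrite subn1.
  have predK x : all (leq 1) x -> map succn (map predn x) = x.
    by move=> x0; rewrite predE; have := map_subnK x0.
  move=> tS t0; have tS' : t \in filter (fun t => 0 < head 0 t)%N S
    by rewrite mem_filter t0.
  rewrite -(predK t) ?pos //.
  apply: (IHM S' _ _ _ (fun t' => c (map succn t'))).
  - rewrite map_inj_in_uniq ?filter_uniq // => x y /pos/predK xK /pos/predK yK
    xy.
    by rewrite -xK xy yK.
  - move=> _ /mapP[x xS ->]; rewrite predE size_map.
    have := xS; rewrite mem_filter => /andP[_ /S_gap[sx ->]]; split=> //.
    by apply: gap_map_subn => //; exact: pos.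
  - move=> x' /mapP[x]; rewrite mem_filter => /andP[x0 /SM xM] ->.
    by case: x x0 xM => //= i x; lia.
  - rewrite big_map big_seq; under eq_bigr => x xS do rewrite predK ?pos //.
    rewrite -big_seq.
    have := congr1 (lowering m L.+1) cS; rewrite linear0 linear_sum => cS'.
    have sg0 : (-1) ^+ L.+1 != 0 :> C by rewrite signr_eq0.
    apply: (scalerI sg0); rewrite scaler0 -[RHS]cS'.
    rewrite [RHS](sum_filter (P := fun t => 0 < head 0 t)%N).
      rewrite scaler_sumr; apply: eq_big_seq => x.
      rewrite mem_filter => /andP[x0 /S_gap[sx xL]].
      by rewrite [RHS]linearZ /= -xL lowering_bword // gtn_eqF // !scalerA
        mulrC.
    move=> x /S_gap[sx xL]; rewrite -leqNgt leqn0 => x0.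
    by rewrite linearZ /= -xL lowering_bword // x0; case: x xL {sx x0} => // *;
      rewrite scaler0.
  - exact: map_f.
move=> t tS; have [/eqP|t0] := posnP (head 0%N t); last exact: cpos.
move=> t0; pose sh x := map (subn^~ (2 * m))%N (behead x).
pose S' := map sh (filter (fun t => head 0 t == 0)%N S).
have S0 x : x \in filter (fun t => head 0 t == 0)%N S ->
    exists y, [/\ x = 0%N :: y, all (leq (2 * m)) y, sorted gap y & size y = L].
  rewrite mem_filter => /andP[x0 /S_gap[]]; case: x x0 => //= i x /eqP->
    sx [xL].
  by exists x; split => //;
    [exact: order_path_min gap_trans sx|exact: path_sorted sx].
have shK x : x \in filter (fun t => head 0 t == 0)%N S ->
    0%N :: map (addn (2 * m)) (sh x) = x.
  by move=> /S0[y [-> y2m _ _]]; rewrite /sh /= map_subnK.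
have tS' : t \in filter (fun t => head 0 t == 0)%N S by rewrite mem_filter t0.
rewrite -(shK t) //.
apply: (IHL (p - (2 * m)%:Z) S' _ _ (fun y => c (0%N :: map (addn (2 * m)) y))).
- by rewrite map_inj_in_uniq ?filter_uniq // => x y /shK{2}<- /shK{2}<- ->.
- move=> _ /mapP[x /S0[y [-> y2m sy yL]] ->]; rewrite /sh /= size_map;
  split=> //.
  exact: gap_map_subn.
- rewrite big_map -[RHS]cS [RHS](sum_filter (P := fun t => head 0%N t == 0%N)).
    apply: eq_big_seq => x xS; rewrite shK //; congr (_ *: _).
    by have [y [-> y2m _ _]] := S0 x xS; rewrite bword0.
  by move=> x xS x0; rewrite cpos ?scale0r // lt0n.
- exact: map_f.
Qed.

(** The eigenvalue of h_0 on products of n vertex operators applied to v_p. *)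
Definition weight p (n : nat) : C := (- p)%:~R / s + n%:R * s.

Lemma heis0_bword p t : heis 0 (bword p t) = weight p (size t) *: bword p t.
Proof.
rewrite /bword -(size_map (fun i : nat => p - 1 - i%:Z)).
elim: (map _ t) => [|j js IH] /=.
  by rewrite /weight mul0r addr0; exact: heis0_hwv.
rewrite heis0_vop // IH linearZ /= -scalerDl; congr (_ *: _).
by rewrite /weight -addn1 natrD; ring.
Qed.

Lemma weight_inj p : injective (weight p).
Proof.
move=> a b /addrI /(mulIf (sqrt2m_neq0 C m_gt0)) /eqP.
by rewrite eqr_nat => /eqP.
Qed.

(** Products of different lengths are eigenvectors of h_0 with different
    eigenvalues, so a relation splits according to the length. *)
Lemma bword_free p S : uniq S -> {in S, forall t, sorted gap t} -> free_on p S.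
Proof.
move=> uS S_gap.
have [B SB] : exists B, {in S, forall t, size t < B}%N.
  exists (\sum_(t <- S) size t).+1 => t tS.
  by rewrite ltnS (big_rem t) //= leq_addr.
elim: B S uS S_gap SB => [|B IHB] S uS S_gap SB c cS; first by move=> t /SB.
have c0 t : t \in S -> (size t < B)%N -> c t = 0.
  (* h_0 - weight p B kills the words of length B and rescales the shorter
     ones. *)
  move=> tS tB; pose f : {linear Fock C -> Fock C} :=
    heis 0 \- (weight p B \*: idfun).
  have fE x : f (c x *: bword p x) =
    (c x * (weight p (size x) - weight p B)) *: bword p x.
    by rewrite linearZ /f /= heis0_bword -scalerBl scalerA.
  have tS' : t \in filter (fun t => size t < B)%N S by rewrite mem_filter tB.
  have : c t * (weight p (size t) - weight p B) = 0.
    apply: (IHB (filter (fun t => size t < B)%N S) _ _ _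
      (fun t => c t * (weight p (size t) - weight p B)) _ t tS').
    - exact: filter_uniq.
    - by move=> x; rewrite mem_filter => /andP[_ /S_gap].
    - by move=> x; rewrite mem_filter => /andP[].
    - have := congr1 f cS; rewrite linear0 linear_sum => cS'; rewrite -[RHS]cS'.
      rewrite [RHS](sum_filter (P := fun t => size t < B)%N).
        by apply: eq_bigr => x _; rewrite fE.
      move=> x /SB; rewrite ltnS leq_eqVlt => /orP[/eqP xB _|->//].
      by rewrite fE xB subrr mulr0 scale0r.
  move/eqP; rewrite mulf_eq0 subr_eq0 (inj_eq (@weight_inj p)) (ltn_eqF tB)
    orbF.
  by move/eqP.
move=> t tS; have := SB t tS; rewrite ltnS leq_eqVlt => /orP[/eqP tB|];
  last exact: c0.
apply: (@bword_free_size B p (filter (fun t => size t == B) S) _ _ c).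
- exact: filter_uniq.
- by move=> x; rewrite mem_filter => /andP[/eqP xB /S_gap].
- rewrite -[RHS]cS [RHS](sum_filter (P := fun t => size t == B)) // => x xS xB.
  have := SB x xS; rewrite ltnS leq_eqVlt (negPf xB) /= => /(c0 x xS) ->.
  by rewrite scale0r.
- by rewrite mem_filter tB eqxx.
Qed.

End Independence.

(** * Interpolation in the quadratic relations *)

(** The left hand side is the shape of a coefficient of the square of the i-th
    derivative; as the falling factorials vanish outside its range, it can be
    taken over all pairs of indices with sum n. *)
Lemma sum_ffact_shift (C : fieldType) (V : lmodType C) (z : nat -> V) n i :
  (i + i <= n)%N ->
  \sum_(x < (n - (i + i)).+1) ((x + i) ^_ i * (n - (x + i)) ^_ i)%:R *: z (x +
    i)%N =
  \sum_(x < n.+1) (x ^_ i * (n - x) ^_ i)%:R *: z x.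
Proof.
move=> ni.
(* The cut at n makes F vanish beyond n also for i = 0. *)
pose F x : V :=
  if (x <= n)%N then (x ^_ i * (n - x) ^_ i)%:R *: z x else 0.
transitivity (\sum_(x < n.+1) F (x + i)%N).
  have le : ((n - (i + i)).+1 <= n.+1)%N by rewrite ltnS leq_subr.
  rewrite (big_ord_widen n.+1
    (fun x => ((x + i) ^_ i * (n - (x + i)) ^_ i)%:R *: z (x + i)%N) le).
  rewrite big_mkcond; apply: eq_bigr => x _; rewrite /F.
  case: ltnP => xn; first by rewrite ifT //; lia.
  case: leqP => // xin.
  by rewrite (@ffact_small (n - (x + i))%N) ?muln0 ?scale0r //; lia.
rewrite sum_shift /F => [|t]; last by rewrite ltnNge => /negPf ->.
rewrite big_mkcond; apply: eq_bigr => x _.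
have -> : (x <= n)%N by rewrite -ltnS.
by case: leqP => // xi; rewrite (ffact_small xi) scale0r.
Qed.

(** x and n - x differ by at least 2m; stated without truncated subtraction. *)
Definition far m n x := (x + x + 2 * m <= n)%N || (n + 2 * m <= x + x)%N.

Section Interpolation.

Variables (C : numClosedFieldType) (V : lmodType C) (m n : nat) (z : nat -> V).
Hypothesis m_gt0 : (0 < m)%N.
Hypothesis z_sym : forall a b, (a + b = n)%N -> z a = z b.
Hypothesis z_rel : forall i, (i < m)%N ->
  \sum_(x < n.+1) (x ^_ i * (n - x) ^_ i)%:R *: z x = 0.

Lemma ffactR (x i : nat) : (x ^_ i)%:R = \prod_(l < i) (x%:R - l%:R) :> C.
Proof.
elim: i => [|i IH]; first by rewrite big_ord0.
rewrite big_ord_recr /= -IH ffactnSr natrM; have [ix|xi] := leqP i x.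
  by rewrite natrB.
by rewrite ffact_small // !mul0r.
Qed.

(** In y = x (n - x) the coefficient x^_i (n - x)^_i is the Newton polynomial
    prod_(l < i) (y - l (n - l)), of degree i. For i < m these span the
    polynomials of degree less than m. *)
Lemma poly_relation (q : {poly C}) : (size q <= m)%N ->
  \sum_(x < n.+1) q.[(x * (n - x))%:R] *: z x = 0.
Proof.
suff rel d (p : {poly C}) : (d <= m)%N -> (size p <= d)%N ->
    \sum_(x < n.+1) p.[(x * (n - x))%:R] *: z x = 0.
  exact: rel.
elim: d p => {q} [|d IH] q dm qd.
  move: qd; rewrite leqn0 size_poly_eq0 => /eqP->.
  by rewrite big1 // => x _; rewrite horner0 scale0r.
pose N : {poly C} := \prod_(l <- iota 0 d) ('X - (l%:R * (n%:R - l%:R))%:P).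
have sN : size N = d.+1 by rewrite size_prod_XsubC size_iota.
have N1 : N`_d = 1.
  have /monicP : N \is monic by exact: monic_prod_XsubC.
  by rewrite /lead_coef sN.
have NE (x : 'I_n.+1) : N.[(x * (n - x))%:R] = (x ^_ d * (n - x) ^_ d)%:R.
  rewrite [RHS]natrM !ffactR -big_split /= horner_prod -[d in iota 0 d]subn0.
  rewrite -/(index_iota 0 d) big_mkord; apply: eq_bigr => l _.
  by rewrite hornerXsubC natrM natrB -1?ltnS //; ring.
have -> : q = (q - q`_d *: N) + q`_d *: N by rewrite subrK.
under eq_bigr do rewrite hornerD hornerZ scalerDl NE -scalerA.
rewrite big_split /= -scaler_sumr.
rewrite z_rel // scaler0 addr0; apply: IH; first exact: ltnW.
apply/leq_sizeP => j; rewrite leq_eqVlt => /orP[/eqP <-|dj];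
  rewrite coefB coefZ.
  by rewrite N1 mulr1 subrr.
by rewrite (nth_default 0 (leq_trans qd dj)) [N`_j]nth_default ?sN // mulr0
  subrr.
Qed.

(** At most m values of y = x (n - x) belong to the x with |2x - n| < 2m. A
    polynomial of degree less than m that vanishes at all of them except a b
    turns poly_relation into an expression of z a through the far terms. *)
Lemma near_in_span_far a b : (a + b = n)%N -> (a <= b)%N -> (b < a + 2 * m)%N ->
  exists e : nat -> C, z a = \sum_(x < n.+1 | far m n x) e x *: z x.
Proof.
move=> abn ab bam; pose h := n./2.
have hn : (h + h <= n <= h + h + 1)%N.
  by rewrite /h; lia.
(* y t is the value of x (n - x) at x = h - t; the x at distance
   less than 2m from n - x have t < m. *)
pose y (t : nat) : int := (h%:Z - t%:Z) * (n%:Z - h%:Z + t%:Z).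
have yinj : injective y.
  move=> t t' /eqP; rewrite -subr_eq0.
  have -> : y t - y t' = (t'%:Z - t%:Z) * (n%:Z - h%:Z - h%:Z + t%:Z + t'%:Z).
    by rewrite /y; ring.
  by rewrite mulf_eq0 => /orP[] /eqP; lia.
have yE x : (x <= h)%N -> y (h - x)%N = (x * (n - x))%N%:Z.
  by move=> xh; rewrite /y PoszM -!subzn; [ring|lia..].
pose ta := (h - a)%N; have tam : (ta < m)%N by rewrite /ta; lia.
have ah : (a <= h)%N by lia.
pose yC t : C := (y t)%:~R.
have yCinj : injective yC by move=> t t' /intr_inj/yinj.
pose r := map yC (rem ta (iota 0 m)).
pose Q : {poly C} := \prod_(c <- r) ('X - c%:P).
have ta_iota : ta \in iota 0 m by rewrite mem_iota.
have sQ : (size Q <= m)%N.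
  by rewrite size_prod_XsubC size_map size_rem // size_iota prednK.
have Qroot (x t : nat) : (x * (n - x))%N%:Z = y t ->
    (Q.[(x * (n - x))%:R] == 0) = (t != ta) && (t < m)%N.
  move=> xt; rewrite (_ : (x * (n - x))%:R = yC t); last by rewrite /yC -xt.
  rewrite -/(root Q _) root_prod_XsubC /r (mem_map yCinj).
  by rewrite mem_rem_uniq ?iota_uniq // inE /= mem_iota.
have Qa : Q.[(a * (n - a))%:R] != 0 by rewrite (Qroot a ta) ?eqxx // yE.
have na : (n - a = b)%N by lia.
have nb : (n - b = a)%N by lia.
pose w := Q.[(a * b)%:R]; have w0 : w != 0 by rewrite /w -na.
pose F x : V := Q.[(x * (n - x))%:R] *: z x.
(* The near indices other than a and b drop out; I2 has one element if a = b and
   two otherwise. *)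
pose I2 := [pred x : 'I_n.+1 | (x == a :> nat) || (x == b :> nat)].
have I2n : (#|I2|%:R : C) != 0.
  have an : (a < n.+1)%N by lia.
  rewrite pnatr_eq0 -lt0n; apply/card_gt0P; exists (Ordinal an).
  by rewrite inE /= eqxx.
have near : \sum_(x < n.+1 | ~~ far m n x) F x = (#|I2|%:R * w) *: z a.
  transitivity (\sum_(x in I2) w *: z a); last first.
    by rewrite sumr_const -scaler_nat scalerA.
  rewrite big_mkcond [RHS]big_mkcond; apply: eq_bigr => x _.
  rewrite inE /= /F; have xn : (x <= n)%N by rewrite -ltnS.
  have [->|xa] /= := eqVneq (x : nat) a.
    by rewrite na ifT // /far; lia.
  have [->|xb] /= := eqVneq (x : nat) b.
    by rewrite nb mulnC -(z_sym abn) ifT // /far; lia.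
  case: ifP => // xfar; suff /eqP -> :
    Q.[(x * (n - x))%:R] == 0 by rewrite scale0r.
  move: xfar; rewrite /far => xfar.
  have [xh|hx] := leqP x h.
    by rewrite (Qroot x (h - x)%N) ?yE //; apply/andP; split; move: xa;
      rewrite /ta; lia.
  have nxh : (n - x <= h)%N by lia.
  rewrite (Qroot x (h - (n - x))%N); last first.
    by rewrite yE // mulnC subKn.
  by apply/andP; split; move: xb; rewrite /ta; lia.
exists (fun x => - (#|I2|%:R * w)^-1 * Q.[(x * (n - x))%:R]).
have rel : \sum_(x < n.+1) F x = 0 by exact: poly_relation.
rewrite (bigID (fun x : 'I_n.+1 => far m n x)) /= near in rel.
have k0 : #|I2|%:R * w != 0 by rewrite mulf_neq0.
apply: (scalerI k0); rewrite scaler_sumr.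
transitivity (- \sum_(x < n.+1 | far m n x) F x).
  by apply/eqP; rewrite -addr_eq0 addrC rel.
rewrite -sumrN; apply: eq_bigr => x _; rewrite scalerA mulrA mulrN mulfV //.
by rewrite mulN1r scaleNr.
Qed.

End Interpolation.

(** * Monomials as sorted lists of indices *)

Section ListMonomials.

Definition mon_of_seq (s : seq nat) : {cmonom nat} :=
  foldr (fun i mu => mulcm (ucm i) mu) (onecm nat) s.

Definition mon_indices (mu : {cmonom nat}) : seq nat :=
  sort leq (flatten [seq nseq (mu i) i | i <- finsupp mu]).

Lemma mon_of_seqE s i : mon_of_seq s i = count_mem i s.
Proof. by elim: s => [|j s IH] /=; rewrite ?onecmE // mulcmE ucmE IH. Qed.

Lemma count_mon_indices mu i : count_mem i (mon_indices mu) = mu i.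
Proof.
rewrite /mon_indices (permP (permEl (perm_sort _ _))) count_flatten -map_comp
  sumnE big_map.
have E j : (count_mem i \o (fun i => nseq (mu i) i)) j = ((j == i) * mu j)%N.
  by rewrite /= count_nseq.
under eq_bigr do rewrite E.
have [imu|imu] := boolP (i \in finsupp mu); last first.
  rewrite big_seq big1 => [|j jmu]; last by case: eqP jmu imu => [->->|].
  by apply/esym/eqP; rewrite cmE_eq0.
rewrite (bigD1_seq i) ?fset_uniq //= eqxx mul1n big1 ?addn0 // => j /negPf ->.
by rewrite mul0n.
Qed.

Lemma mon_indicesK : cancel mon_indices mon_of_seq.
Proof.
by move=> mu; apply/eqP/cmP => i; rewrite mon_of_seqE count_mon_indices.
Qed.

Lemma mon_of_seqK s : mon_indices (mon_of_seq s) = sort leq s.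
Proof.
apply: (sorted_eq leq_trans anti_leq); rewrite ?sort_sorted //;
  try exact: leq_total.
apply/allP => i _ /=.
by rewrite count_mon_indices mon_of_seqE (permP (permEl (perm_sort _ _))).
Qed.

Lemma mon_indices_inj : injective mon_indices.
Proof. exact: can_inj mon_indicesK. Qed.

Variable (C : numClosedFieldType).

Lemma prod_xi s : \prod_(i <- s) xi C i = << mon_of_seq s >>.
Proof.
elim: s => [|i s IH]; first by rewrite big_nil.
rewrite big_cons IH malgM_def fgmulUU mulr1; exact: erefl.
Qed.

Lemma xi_derivE i k : xi_deriv C i k = xi C (k + i) *+ ((k + i) ^_ i).
Proof.
elim: i k => [|i IH] k; first by rewrite addn0 ffactn0 mulr1n.
rewrite /xi_deriv iterS -/(xi_deriv C i) /fps_deriv IH -mulrnA addSnnS.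
by rewrite ffactnSr; congr (_ *+ (_ * _)); lia.
Qed.

End ListMonomials.

(** * Monomials with gaps span the algebra *)

Section Spanning.

Variables (C : numClosedFieldType) (m : nat).
Hypothesis m_gt0 : (0 < m)%N.

Local Notation xiA := (@xiA C m).
Local Notation A := (A_alg C m).
Local Notation A_pi := (@A_pi C m).
Local Notation polyxi := {malg C[{cmonom nat}]}.

Lemma A_pi_eq0 q : (A_pi q == 0) = (q \in @A_ideal C m).
Proof.
rewrite -[q in RHS]subr0 Quotient.idealrBE -[X in _ == X](rmorph0 A_pi).
exact: erefl.
Qed.

Lemma A_relation_eq0 q : A_relation m q -> A_pi q = 0.
Proof.
move=> qr; apply/eqP; rewrite A_pi_eq0; apply/asboolP; exists [:: (1, q)].
by split=> [c|]; rewrite ?inE ?big_seq1 ?mul1r // => /eqP->.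
Qed.

Lemma ffact_relation n i : (i < m)%N ->
  \sum_(x < n.+1) (x ^_ i * (n - x) ^_ i)%:R *: (xiA x * xiA (n - x)%N) = 0.
Proof.
move=> im; have [ni|ni] := ltnP n (i + i).
  rewrite big1 // => x _; have [xi|xi] := ltnP x i.
    by rewrite (ffact_small xi) scale0r.
  by rewrite (@ffact_small (n - x)%N) ?muln0 ?scale0r //; lia.
rewrite -(sum_ffact_shift (fun x => xiA x * xiA (n - x)%N) ni).
have /A_relation_eq0 : A_relation m (fps_mul (xi_deriv C i) (xi_deriv C i)
  (n - (i + i))%N).
  by exists i => //; exists (n - (i + i))%N.
rewrite /fps_mul rmorph_sum => rel; rewrite -[RHS]rel; apply: eq_bigr => x _.
have e1 : (n - (i + i) - x + i = n - (x + i))%N by have := ltn_ord x; lia.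
rewrite !xi_derivE e1 mulrnAl mulrnAr -mulrnA (rmorphMn A_pi) (rmorphM A_pi).
by rewrite -scaler_nat mulnC.
Qed.

Definition admissible_supp (q : polyxi) :=
  forall mu, q@_mu != 0 -> sorted (gap m) (mon_indices mu).

Definition spanned (x : A) := exists2 q, admissible_supp q & x = A_pi q.

Lemma spanned_sum (I : Type) (r : seq I) (P : pred I) (c : I -> C) (F : I ->
  A) :
  (forall i, P i -> spanned (F i)) -> spanned (\sum_(i <- r | P i) c i *: F i).
Proof.
move=> FP; elim/big_ind: _ => [|x y [q qa ->] [q' qa' ->]|i Pi].
- by exists 0; [move=> mu; rewrite mcoeff0 eqxx|rewrite rmorph0].
- exists (q + q'); last by rewrite rmorphD.
  move=> mu; rewrite mcoeffD; have [q0|/qa //] := eqVneq (q@_mu) 0.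
  by rewrite q0 add0r; exact: qa'.
- have [q qa ->] := FP i Pi; exists (c i *: q); last by rewrite A_piZ.
  by move=> mu; rewrite mcoeffZ mulf_eq0 negb_or => /andP[_ /qa].
Qed.

Lemma A_straighten a b : (a <= b)%N -> (b < a + 2 * m)%N ->
  exists e : nat -> C, xiA a * xiA b =
    \sum_(x < (a + b).+1 | far m (a + b) x) e x *: (xiA x * xiA (a + b - x)%N).
Proof.
move=> ab bam; pose z x : A := xiA x * xiA (a + b - x)%N.
have zE x y : (x + y = a + b)%N -> z x = xiA x * xiA y.
  by move=> xy; rewrite /z; congr (_ * xiA _); lia.
have z_sym x y : (x + y = a + b)%N -> z x = z y.
  move=> xy; have yx : (y + x = a + b)%N by rewrite addnC.
  by rewrite (zE x y xy) (zE y x yx); exact: mulrC.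
have [e eE] := near_in_span_far m_gt0 z_sym (@ffact_relation (a + b)%N) erefl
  ab bam.
exists e; transitivity (z a); last exact: eE.
exact: esym (zE a b erefl).
Qed.

Lemma A_scaleAr a (x y : A) : x * (a *: y) = a *: (x * y).
Proof. by rewrite mulrC -A_scaleAl [y * x]mulrC. Qed.

Lemma mulr_pair_swap (R : comPzRingType) (l x y r : R) :
  l * (x * (y * r)) = l * r * (x * y).
Proof. by ring. Qed.

Lemma sq_spread x d g : (0 < d)%N ->
  ((x + d) ^ 2 + (x + d + g) ^ 2 < x ^ 2 + (x + d + g + d) ^ 2)%N.
Proof. by move=> d0; nia. Qed.

Lemma far_sq a b x : (a <= b)%N -> (b < a + 2 * m)%N -> far m (a + b) x ->
  (x <= a + b)%N ->
  (a ^ 2 + b ^ 2 < x ^ 2 + (a + b - x) ^ 2)%N.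
Proof.
move=> ab bam /orP[] xfar xab.
  have := @sq_spread x (a - x) (b - a).
  have -> : (x + (a - x) = a)%N by lia.
  have -> : (a + (b - a) = b)%N by lia.
  have -> : (b + (a - x) = a + b - x)%N by lia.
  by apply; lia.
have := @sq_spread (a + b - x) (x - b) (b - a).
have -> : (a + b - x + (x - b) = a)%N by lia.
have -> : (a + (b - a) = b)%N by lia.
have -> : (b + (x - b) = x)%N by lia.
by rewrite [(x ^ 2 + _)%N]addnC; apply; lia.
Qed.

Lemma gapPn (s : seq nat) : ~~ sorted (gap m) s ->
  exists l a b r, s = l ++ [:: a, b & r] /\ ~~ gap m a b.
Proof.
elim: s => // a [//|b r] IH /=; have [ab /= nbr|nab _] := boolP (gap m a b).
  by have [l [a' [b' [r' [-> nab]]]]] := IH nbr; exists (a :: l), a', b', r'.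
by exists [::], a, b, r.
Qed.

(** Two indices at distance less than 2m are replaced by pairs with the same
    sum that lie further apart. This increases the sum of the squares of the
    indices, which is bounded by the square of their sum, so the process ends.
    *)
Lemma spanned_prod (s : seq nat) : spanned (\prod_(i <- s) xiA i).
Proof.
pose sq (s : seq nat) := (\sum_(i <- s) i ^ 2)%N.
have sq_le t : (sq t <= sumn t ^ 2)%N.
  by elim: t => [|i t]; rewrite /sq ?big_nil // big_cons /=; nia.
have finish t : sorted leq t -> sorted (gap m) t ->
  spanned (\prod_(i <- t) xiA i).
  move=> t_leq t_gap; exists << mon_of_seq t >>.
    move=> mu; rewrite mcoeffU1; case: (mon_of_seq t =P mu) => [<- _|_];
      last by rewrite eqxx.
    by rewrite mon_of_seqK sorted_sort //; exact: leq_trans.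
  by rewrite -prod_xi rmorph_prod.
have key t : (forall u, sumn u = sumn t -> (sq t < sq u)%N ->
  spanned (\prod_(i <- u) xiA i)) ->
    spanned (\prod_(i <- t) xiA i).
  move=> IH; pose t' := sort leq t.
  have tt' : perm_eq t t' by rewrite perm_sym; exact/permEl/perm_sort.
  have t'_leq : sorted leq t' by apply: sort_sorted; exact: leq_total.
  rewrite (perm_big _ tt'); have [|/gapPn[l [a [b [r [t'E nab]]]]]] :=
    boolP (sorted (gap m) t').
    exact: finish.
  have ab : (a <= b)%N.
    by move: t'_leq; rewrite t'E => /cat_sorted2[_ /= /andP[]].
  have sum_t : sumn t = (sumn l + (a + (b + sumn r)))%N.
    by rewrite (perm_sumn tt') t'E sumn_cat.
  have sq_t : sq t = (sq l + (a ^ 2 + (b ^ 2 + sq r)))%N.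
    by rewrite /sq (perm_big _ tt') t'E big_cat !big_cons.
  have prodE x y : \prod_(i <- l ++ [:: x, y & r]) xiA i =
     (\prod_(i <- l) xiA i * \prod_(i <- r) xiA i) * (xiA x * xiA y).
    rewrite big_cat !big_cons /=; exact: mulr_pair_swap.
  rewrite t'E prodE.
  have bam : (b < a + 2 * m)%N by rewrite ltnNge.
  have [e ->] := A_straighten ab bam.
  rewrite mulr_sumr (eq_bigr (fun x : 'I_(a + b).+1 => e x *:
    \prod_(i <- l ++ [:: nat_of_ord x, (a + b - x)%N & r]) xiA i)); last first.
    by move=> x _; rewrite prodE; exact: A_scaleAr.
  apply: spanned_sum => x xfar; have xab := ltn_ord x; apply: IH.
    by rewrite sumn_cat /= sum_t; lia.
  have {}xab : (x <= a + b)%N by rewrite -ltnS.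
  rewrite sq_t /sq big_cat !big_cons /= -/(sq l) -/(sq r).
  by have := far_sq ab bam xfar xab; lia.
have [N] : exists N, (sumn s ^ 2 <= sq s + N)%N.
  by exists (sumn s ^ 2)%N; exact: leq_addl.
elim: N s => [|N IH] s sN; apply: key => // u su squ.
  by have := sq_le u; rewrite su; lia.
by apply: IH; rewrite su; lia.
Qed.

End Spanning.

(** * Evaluation of polynomials on the highest weight vector *)

Section Comparison.

Variables (C : numClosedFieldType) (m : nat) (p : int).
Hypothesis m_gt0 : (0 < m)%N.

Local Notation polyxi := {malg C[{cmonom nat}]}.
Local Notation vop := (@vop C m).
Local Notation word := (@vop_word C m).
Local Notation bword := (@bword C m p).
Local Notation xi := (xi C).
Local Notation A_pi := (@A_pi C m).
Implicit Types q r : polyxi.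

(** The evaluation q |-> q(a_(p-1), a_(p-2), ...) v_p of polynomials at
    commuting operators, defined through the monomials because it is only a
    linear map. *)
Definition word_map (q : polyxi) : Fock C :=
  \sum_(mu <- msupp q) q@_mu *: bword (mon_indices mu).

Lemma word_mapEw (d : {fset {cmonom nat}}) q : (msupp q `<=` d)%fset ->
  word_map q = \sum_(mu <- d) q@_mu *: bword (mon_indices mu).
Proof.
move=> le; rewrite /word_map (big_fset_incl _ le) // => mu _ /mcoeff_outdom ->.
by rewrite scale0r.
Qed.

Lemma word_map_is_linear : linear word_map.
Proof.
move=> a q r; pose d := (msupp (a *: q + r) `|` (msupp q `|` msupp r))%fset.
rewrite (@word_mapEw d) ?fsubsetUl // (@word_mapEw d q); last first.
  by rewrite /d fsetUCA fsubsetUl.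
rewrite (@word_mapEw d r); last by rewrite /d fsetUA fsubsetUr.
rewrite scaler_sumr -big_split; apply: eq_bigr => mu _ /=.
by rewrite mcoeffD mcoeffZ scalerDl scalerA.
Qed.

HB.instance Definition _ :=
  GRing.isLinear.Build C polyxi (Fock C) *:%R word_map word_map_is_linear.

Lemma word_mapU mu : word_map << mu >> = bword (mon_indices mu).
Proof. by rewrite /word_map msuppU1 big_seq_fset1 mcoeffU1 eqxx scale1r. Qed.

Lemma bword_perm s t : perm_eq s t -> bword s = bword t.
Proof. by move=> st; apply/word_perm/perm_map. Qed.

Lemma word_map_prod s : word_map (\prod_(i <- s) xi i) = bword s.
Proof.
rewrite prod_xi word_mapU mon_of_seqK; apply: bword_perm.
exact/permEl/perm_sort.
Qed.

Lemma malgUZ (c : C) (mu : {cmonom nat}) : << c *g mu >> = c *: << mu >>.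
Proof.
apply: (malgP _ _).1 => nu.
rewrite mcoeffZ [LHS]mcoeffU mcoeffU1.
exact: esym (mulr_natr _ _).
Qed.

Lemma malg_prodE q : q = \sum_(mu <- msupp q) q@_mu *: \prod_(i <- mon_indices
  mu) xi i.
Proof.
by rewrite {1}[q]monalgE; apply: eq_bigr => mu _;
  rewrite malgUZ prod_xi mon_indicesK.
Qed.

Lemma malgZAl (c : C) q r : (c *: q) * r = c *: (q * r).
Proof. exact: esym (scalerAl _ _ _). Qed.

Lemma malgZAr (c : C) q r : q * (c *: r) = c *: (q * r).
Proof. by rewrite mulrC malgZAl [r * q]mulrC. Qed.

Lemma word_map_xi_mul i q : word_map (xi i * q) =
  vop (p - 1 - i%:Z) (word_map q).
Proof.
rewrite {1}[q]malg_prodE mulr_sumr !linear_sum; apply: eq_bigr => mu _.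
rewrite malgZAr !linearZ; congr (_ *: _).
transitivity (word_map (\prod_(j <- i :: mon_indices mu) xi j));
  first by rewrite big_cons.
by rewrite word_map_prod; congr (vop _ _); exact: esym (word_map_prod _).
Qed.

Lemma word_map_xi_xi a b :
  word_map (xi a * xi b) = vop (p - 1 - a%:Z) (vop (p - 1 - b%:Z) (vp C p)).
Proof.
transitivity (word_map (\prod_(i <- [:: a; b]) xi i));
  last exact: word_map_prod.
rewrite 2!big_cons big_nil.
congr (word_map (_ * _)); exact: esym (mulr1 _).
Qed.

Definition ffact_poly (n i : nat) : {poly C} :=
  \prod_(l <- iota 0 i) ('X - (l%:R)%:P) *
  ((-1) ^+ i *: \prod_(l <- iota 0 i) ('X - (n%:R - l%:R)%:P)).

Lemma size_ffact_poly n i : (size (ffact_poly n i) <= i + i.+1)%N.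
Proof.
apply: leq_trans (size_polyMleq _ _) _; rewrite size_scale ?signr_eq0 //.
by rewrite !size_prod_XsubC !size_iota addSn.
Qed.

Lemma horner_ffact_poly n i x : (x <= n)%N ->
  (ffact_poly n i).[x%:R] = (x ^_ i * (n - x) ^_ i)%:R.
Proof.
move=> xn; rewrite hornerM hornerZ !horner_prod natrM !ffactR.
rewrite -[i in iota 0 i]subn0 -/(index_iota 0 i) !big_mkord.
have -> : (-1 : C) ^+ i = \prod_(l < i) -1 by rewrite prodr_const card_ord.
rewrite -big_split; congr (_ * _); apply: eq_bigr => l _ /=;
  rewrite hornerXsubC //.
by rewrite natrB //; ring.
Qed.

(** The relation attached to the i-th derivative is an instance of vop_quad
    with the polynomial x^_i (n - x)^_i in x, whose degree 2i is less than 2m.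
    *)
Lemma word_map_relation q : A_relation m q -> word_map q = 0.
Proof.
move=> [i im [k ->]]; pose n := (k + (i + i))%N.
pose z x := vop (p - 1 - x%:Z) (vop (p - 1 - (n%:Z - x%:Z)) (vp C p)).
have kE : k = (n - (i + i))%N by rewrite /n addnK.
transitivity (\sum_(x < n.+1) (x ^_ i * (n - x) ^_ i)%:R *: z x).
  rewrite -(sum_ffact_shift z) ?leq_addl // -kE /fps_mul linear_sum.
  apply: eq_bigr => x _; have xk := ltn_ord x.
  rewrite !xi_derivE mulrnAl mulrnAr -mulrnA raddfMn /= -scaler_nat mulnC.
  have e1 : (k - x + i = n - (x + i))%N by rewrite /n; lia.
  rewrite e1; congr (_ *: _).
  rewrite word_map_xi_xi /z.
  by congr (vop _ (vop _ _)); rewrite /n; lia.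
rewrite -[RHS](@vop_quad C m (ffact_poly n i) n p); last first.
  by rewrite (leq_trans (size_ffact_poly _ _)) //; lia.
by apply: eq_bigr => x _; rewrite horner_ffact_poly // -ltnS.
Qed.

Lemma word_map_ideal q : q \in @A_ideal C m -> word_map q = 0.
Proof.
move=> /asboolP[s [sG ->]]; rewrite linear_sum big_seq big1 // => -[r g] /sG /=.
move=> /word_map_relation g0; rewrite [r]malg_prodE mulr_suml linear_sum
  big1 // => mu _.
rewrite malgZAl linearZ; apply/eqP; rewrite scaler_eq0; apply/orP; right;
  apply/eqP.
elim: (mon_indices mu) => [|i l IH]; first by rewrite big_nil mul1r.
rewrite big_cons -mulrA; apply: etrans (word_map_xi_mul _ _) _.
apply: etrans (linear0 _); congr (vop _ _); exact: IH.
Qed.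

(** The kernel is the ideal of relations: modulo the ideal, q is a combination
    of monomials with gaps, and their images are linearly independent. *)
Lemma word_map_eq0 q : (word_map q == 0) = (A_pi q == 0).
Proof.
apply/eqP/eqP => [q0|/eqP]; last by rewrite A_pi_eq0 => /word_map_ideal.
have [q' q'adm qq'] : spanned (A_pi q).
  rewrite [q]malg_prodE rmorph_sum; under eq_bigr do rewrite A_piZ rmorph_prod.
  by apply: spanned_sum => mu _; exact: spanned_prod.
have q'0 : word_map q' = 0.
  apply/eqP; rewrite -subr_eq0 -[X in _ - X]q0 -linearB /=;
    apply/eqP/word_map_ideal.
  by rewrite -A_pi_eq0 rmorphB qq' subrr.
suff q'z : q' = 0 by rewrite qq' q'z rmorph0.
apply/malgP => mu; rewrite mcoeff0; apply/eqP/negPn/negP => mu0.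
have := @bword_free C m m_gt0 p (map mon_indices (msupp q')) _ _
  (fun t => q'@_(mon_of_seq t)) _ (mon_indices mu).
rewrite mon_indicesK => /(_ _ _ _ _)/eqP; rewrite (negPf mu0) => H.
have : false; last by [].
apply: H.
- by rewrite map_inj_uniq ?fset_uniq //; exact: mon_indices_inj.
- by move=> _ /mapP[nu nuq ->]; apply: q'adm; rewrite mcoeff_neq0.
- by rewrite big_map -[RHS]q'0; apply: eq_bigr => nu _; rewrite mon_indicesK.
- by apply: map_f; rewrite -mcoeff_neq0.
Qed.

Lemma word_map_principal q : word_map q \in @principal C m p.
Proof.
rewrite /word_map; apply: rpred_sum => mu _; apply: rpredZ;
  apply: vop_word_principal.
by apply/allP => _ /mapP[i _ ->]; lia.
Qed.

Lemma word_as_word_map (js : seq int) : all (fun j => j <= p - 1) js ->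
  word p js = word_map (\prod_(j <- js) xi `|(- j + p - 1)%R|%N).
Proof.
move=> jsP; rewrite -(big_map (fun j => `|(- j + p - 1)%R|%N) xpredT xi)
  word_map_prod.
rewrite /bword -map_comp -[LHS]/(word p js) -[in LHS](map_id js).
congr (word p _); apply/eq_in_map => j /(allP jsP) jp /=; lia.
Qed.

Lemma principal_word_map v : v \in @principal C m p -> exists q, word_map q = v.
Proof.
move=> /asboolP[s [sP ->]].
exists (\sum_(cj <- s) cj.1 *: \prod_(j <- cj.2) xi `|(- j + p - 1)%R|%N).
rewrite linear_sum; apply: eq_big_seq => cj cjs.
by rewrite linearZ (word_as_word_map (sP _ cjs)).
Qed.

(** * The isomorphism *)

Definition preimage (v : principal_space C m p) : polyxi :=
  projT1 (cid (principal_word_map (pvalP v))).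

Lemma preimageK v : word_map (preimage v) = pval v.
Proof. exact: projT2 (cid (principal_word_map (pvalP v))). Qed.

(** By word_map_eq0 the class modulo the relations does not depend on the
    chosen preimage. *)
Definition principal_to_A (v : principal_space C m p) : A_alg C m :=
  A_pi (preimage v).

Lemma principal_to_A_eq v q : word_map q = pval v -> principal_to_A v = A_pi q.
Proof.
move=> qv; apply/eqP; rewrite -subr_eq0 -rmorphB -word_map_eq0 linearB /=
  preimageK qv.
by rewrite subrr.
Qed.

Lemma principal_to_A_is_linear : linear principal_to_A.
Proof.
move=> a u v; rewrite (@principal_to_A_eq _ (a *: preimage u + preimage v)).
  by rewrite rmorphD A_piZ.
by rewrite linearP /= !preimageK.
Qed.

HB.instance Definition _ :=
  GRing.isLinear.Build C (principal_space C m p) (A_alg C m) *:%R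
    principal_to_A principal_to_A_is_linear.

Lemma principal_to_A_bij : bijective principal_to_A.
Proof.
pose g (x : A_alg C m) : principal_space C m p :=
  PrincipalSpace (word_map_principal (repr x)).
exists g => [v|x].
  apply: val_inj => /=; rewrite -preimageK; apply/eqP.
  by rewrite -subr_eq0 -linearB word_map_eq0 rmorphB subr_eq0; apply/eqP;
    exact: reprK.
by rewrite (@principal_to_A_eq _ (repr x)) //; exact: reprK.
Qed.

Lemma principal_to_A_word (js : seq int) (hjs : all (fun j => j <= p - 1) js) :
  principal_to_A (principal_word C m hjs) =
    \prod_(j <- js) xiA C m `|(- j + p - 1)%R|%N.
Proof.
rewrite (@principal_to_A_eq _ (\prod_(j <- js) xi `|(- j + p - 1)%R|%N));
  last by rewrite -word_as_word_map.
by rewrite rmorph_prod.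
Qed.

End Comparison.

Theorem lemma4p2 (R : realType) (m : nat) (hm : (1 <= m)%N) (p : int) :
  exists f : {linear principal_space R[i] m p -> A_alg R[i] m},
    bijective f /\
    forall (js : seq int) (hjs : all (fun j => j <= p - 1) js),
      f (principal_word R[i] m hjs) =
      \prod_(j <- js) xiA R[i] m `|(- j + p - 1)%R|%N.
Proof.
pose f : {linear principal_space R[i] m p -> A_alg R[i] m} := principal_to_A hm.
by exists f; split; [exact: principal_to_A_bij|exact: principal_to_A_word].
Qed.
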